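(* Let $n\ge 3$ and consider positive radial solutions of $$\Delta u+|x|^{l_1}u^{p}+|x|^{l_2}u^{q}=0 .\qquad ( * )$$ (i) If $-2<l_2<l_1\le 0$ and $\frac{n+l_1}{n-2}<p<q<\frac{n+2+2l_2}{n-2}$, then $( * )$ admits exactly one positive radial solution that is singular at infinity. This solution satisfies $$\lim_{r\to\infty}r^{\alpha_1}u(r)=\lambda_1,\qquad \lim_{r\to0}r^{\alpha_2}u(r)=\lambda_2 .$$ (ii) If $-2<l_2<l_1\le 0$ and $\frac{n+2+2l_1}{n-2}<p<q$, then $( * )$ admits exactly one positive radial solution that is singular at the origin. This solution satisfies $$\lim_{r\to\infty}r^{\alpha_1}u(r)=\lambda_1,\qquad \lim_{r\to0}r^{\alpha_2}u(r)=\lambda_2 .$$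
   Context: A positive radial solution is a function $u=u(r)$, $r=|x|$, that is $C^2$ and positive on $(0,\infty)$ and satisfies $u''+\frac{n-1}{r}u'+r^{l_1}u^p+r^{l_2}u^q=0$ for all $r\in(0,\infty)$ (so $u$ may be singular at the origin). Notation: $\alpha_1=\frac{2+l_1}{p-1}$, $\alpha_2=\frac{2+l_2}{q-1}$; $\lambda_1>0$ and $\lambda_2>0$ are defined by $\lambda_1^{p-1}=\alpha_1(n-2-\alpha_1)$ and $\lambda_2^{q-1}=\alpha_2(n-2-\alpha_2)$. A positive radial solution $u$ is singular at infinity if $\limsup_{r\to\infty}r^{\alpha_1}u(r)>0$, and singular at the origin if $\limsup_{r\to0}r^{\alpha_2}u(r)>0$. *)

(* Defs.v *)
From Stdlib Require Import Reals Lra.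
From Coquelicot Require Import Coquelicot.
Open Scope R_scope.

(* A radial function on R^n \ {0} is represented by its profile u : R -> R;
   only the values u r with r > 0 are meaningful.  All real powers below are
   [Rpower] with a positive base. *)

(* [Derive] is total, so C^2 regularity requires both levels of
   differentiability to be stated. *)
Definition C2_on_pos (u : R -> R) : Prop :=
  forall r, 0 < r ->
    ex_derive u r /\ ex_derive (Derive u) r /\ continuous (Derive (Derive u)) r.

(* Nothing is required at r = 0, so u may be singular there. *)
Definition positive_radial_solution (n : nat) (l1 l2 p q : R) (u : R -> R) : Prop :=
  C2_on_pos u /\
  (forall r, 0 < r -> 0 < u r) /\
  (forall r, 0 < r ->
     Derive (Derive u) r + (INR n - 1) / r * Derive u r
     + Rpower r l1 * Rpower (u r) p + Rpower r l2 * Rpower (u r) q = 0).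

Definition alpha (l p : R) : R := (2 + l) / (p - 1).

(* The positive root of x^(p-1) = alpha (n-2-alpha), see [lambda_spec]. *)
Definition lambda (n : nat) (l p : R) : R :=
  Rpower (alpha l p * (INR n - 2 - alpha l p)) (/ (p - 1)).

Lemma lambda_spec (n : nat) (l p : R) :
  -2 < l -> 1 < p -> alpha l p < INR n - 2 ->
  forall x : R,
    (0 < x /\ Rpower x (p - 1) = alpha l p * (INR n - 2 - alpha l p))
    <-> x = lambda n l p.
Proof.
intros Hl Hp Ha x.
assert (Ha0 : 0 < alpha l p) by (apply Rdiv_lt_0_compat; lra).
assert (Hb : 0 < alpha l p * (INR n - 2 - alpha l p))
  by (apply Rmult_lt_0_compat; lra).
unfold lambda; split.
- intros [Hx <-].
  rewrite Rpower_mult, Rinv_r by lra.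
  now rewrite Rpower_1.
- intros ->; split; [apply exp_pos|].
  rewrite Rpower_mult, Rinv_l by lra.
  now apply Rpower_1.
Qed.

(* inf over A in F of sup over A of f, as an extended real *)
Definition LimSup (F : (R -> Prop) -> Prop) (f : R -> R) : Rbar :=
  Rbar_glb (fun y : Rbar =>
    exists A : R -> Prop, F A /\ y = Lub_Rbar (fun z => exists r, A r /\ z = f r)).

Definition singular_at_infinity (l1 p : R) (u : R -> R) : Prop :=
  Rbar_lt 0 (LimSup (Rbar_locally p_infty) (fun r => Rpower r (alpha l1 p) * u r)).

Definition singular_at_origin (l2 q : R) (u : R -> R) : Prop :=
  Rbar_lt 0 (LimSup (at_right 0) (fun r => Rpower r (alpha l2 q) * u r)).

Definition has_limits (n : nat) (l1 l2 p q : R) (u : R -> R) : Prop :=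
  is_lim (fun r => Rpower r (alpha l1 p) * u r) p_infty (lambda n l1 p) /\
  filterlim (fun r => Rpower r (alpha l2 q) * u r) (at_right 0)
    (locally (lambda n l2 q)).

(* Uniqueness is equality of profiles on (0, +oo). *)
Definition is_the_only_profile (S : (R -> R) -> Prop) (u : R -> R) : Prop :=
  S u /\ forall v, S v -> forall r, 0 < r -> v r = u r.

(* Main.v *)
Require Import Defs.
From Stdlib Require Import Reals Lra Lia IndefiniteDescription.
From Coquelicot Require Import Coquelicot.
Open Scope R_scope.

(** In logarithmic time t = sg * ln r, with sg = 1 for the end at infinity and
sg = -1 for the end at the origin, the rescaled profile w = r^th u solves

  w'' = (a - b) w' + a b w - w^P - exp (- nu t) w^Q,   nu = (Q - 1) kappa,

where kappa = alpha1 - alpha2 > 0.  In case (i) take sg = 1, th = alpha1,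
a = alpha1, b = n - 2 - alpha1, (P, Q) = (p, q); in case (ii) take sg = -1,
th = alpha2, a = n - 2 - alpha2, b = alpha2, (P, Q) = (q, p).  The hypotheses on
the exponents become, in both cases, b > 0 and a - b > 2 kappa > 0, and a
profile is singular at the chosen end exactly when w does not tend to 0 as
t -> +oo.  So both cases are one statement: this equation has exactly one
positive solution on the whole line that does not tend to 0 at +oo.

The change of unknown x = exp (- kappa t) w gives an equation of the same shape
with (a, b) replaced by (a - kappa, b + kappa), in which it is now the term in
x^P that carries an exponential factor, and one that decays as t -> -oo
([solves_at_shift]).  The inequality a - b > 2 kappa says that the damping
coefficient a - b keeps its sign under this change, so at each end one has a
damped autonomous equation up to an exponentially small term.

Limits.  A positive solution is superharmonic, which forces -b w <= w' <= a w
([slope_upper], [slope_lower]) and bounds w ([solution_bound]).  The energy then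
shows that w'^2 is integrable near +oo, so w' -> 0 and a b w - w^P -> 0
([solution_settles]); a solution that does not tend to 0 tends to the positive
root of this balance.  For x the energy is increasing in t and tends to 0 at
+oo, hence is negative and bounded away from 0 near -oo.  This keeps x away from
0 there, and the same argument, run in reversed time, gives its limit at -oo
([persistent_solution_backward_limit]).

Uniqueness.  The equilibrium at +oo is repelling because a - b > 0.  A quadratic
Lyapunov function of the difference of two solutions that converge to it is
nondecreasing and tends to 0, so the solutions agree near +oo
([eventual_uniqueness]) and, by Gronwall, everywhere.

Existence.  Start at time N from the equilibrium at rest and solve backward.
The energy of x is negative at N and decreases backward, so x stays in the
potential well, hence positive and bounded, for all t <= N
([negative_energy_confines]); this also makes a truncation of the powers
harmless, so that Picard iteration provides the solution.  The energy of w at N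
is about that of the bottom of its well and can change backward only by an
exponentially small amount, so w stays away from 0 on [T, N] uniformly in N
([negative_energy_persists]).  A cluster point, as N -> oo, of the values at T
starts the required solution ([persistent_solution_exists]). *)

(** * Calculus on the real line *)

Lemma mean_value (f df : R -> R) (a b : R) :
  a <= b -> (forall t, a <= t <= b -> is_derive f t (df t)) ->
  exists c, a <= c <= b /\ f b - f a = df c * (b - a).
Proof.
intros Hab Hd.
destruct (MVT_gen f a b df) as [c [Hc He]].
- intros x Hx. rewrite Rmin_left, Rmax_right in Hx by lra. apply Hd; lra.
- intros x Hx. rewrite Rmin_left, Rmax_right in Hx by lra.
  apply continuity_pt_filterlim, (ex_derive_continuous f x).
  exists (df x). apply Hd; lra.
- rewrite Rmin_left, Rmax_right in Hc by lra. now exists c.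
Qed.

Lemma nondecreasing_of_derive (f df : R -> R) (a b : R) :
  a <= b -> (forall t, a <= t <= b -> is_derive f t (df t)) ->
  (forall t, a <= t <= b -> 0 <= df t) -> f a <= f b.
Proof.
intros Hab Hd Hp. destruct (mean_value f df a b Hab Hd) as [c [Hc He]].
assert (H := Hp c Hc). nra.
Qed.

Lemma is_derive_continuous (f : R -> R) (t l : R) : is_derive f t l -> continuous f t.
Proof. intros H. apply (ex_derive_continuous f t). now exists l. Qed.

Lemma continuous_Rplus (f g : R -> R) (t : R) :
  continuous f t -> continuous g t -> continuous (fun s => f s + g s) t.
Proof. intros Hf Hg. exact (continuous_plus f g t Hf Hg). Qed.

Lemma continuous_Rminus (f g : R -> R) (t : R) :
  continuous f t -> continuous g t -> continuous (fun s => f s - g s) t.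
Proof. intros Hf Hg. exact (continuous_minus f g t Hf Hg). Qed.

Lemma continuous_Rmult (f g : R -> R) (t : R) :
  continuous f t -> continuous g t -> continuous (fun s => f s * g s) t.
Proof. intros Hf Hg. exact (continuous_mult f g t Hf Hg). Qed.

Lemma continuous_eps (f : R -> R) (t : R) :
  continuous f t <->
  (forall eps, 0 < eps -> exists d, 0 < d /\ forall s, Rabs (s - t) < d -> Rabs (f s - f t) < eps).
Proof.
split.
- intros H eps He.
  assert (H1 := proj1 (filterlim_locally f (f t)) H (mkposreal eps He)).
  destruct H1 as [d Hd]. exists d. split; [apply cond_pos|].
  intros s Hs. apply Hd. exact Hs.
- intros H. apply filterlim_locally. intros eps.
  destruct (H eps (cond_pos eps)) as [d [Hd0 Hd]].
  exists (mkposreal d Hd0). intros s Hs. apply Hd. exact Hs.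
Qed.

Lemma is_derive_val (f : R -> R) (t a b : R) : is_derive f t a -> a = b -> is_derive f t b.
Proof. now intros H <-. Qed.

(** These restate the rules of differentiation with the derivative in plain ring
form, where the generic ones speak of the operations of a normed module. *)
Lemma is_derive_Rmult (f g : R -> R) (t a b : R) :
  is_derive f t a -> is_derive g t b ->
  is_derive (fun s => f s * g s) t (a * g t + f t * b).
Proof. intros Hf Hg. apply (is_derive_mult f g t a b Hf Hg). intros; apply Rmult_comm. Qed.

Lemma is_derive_Rplus (f g : R -> R) (t a b : R) :
  is_derive f t a -> is_derive g t b -> is_derive (fun s => f s + g s) t (a + b).
Proof. intros Hf Hg. exact (is_derive_plus f g t a b Hf Hg). Qed.

Lemma is_derive_Rminus (f g : R -> R) (t a b : R) :
  is_derive f t a -> is_derive g t b -> is_derive (fun s => f s - g s) t (a - b).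
Proof. intros Hf Hg. exact (is_derive_minus f g t a b Hf Hg). Qed.

Lemma is_derive_Ropp (f : R -> R) (t a : R) :
  is_derive f t a -> is_derive (fun s => - f s) t (- a).
Proof. intros Hf. exact (is_derive_opp f t a Hf). Qed.

Lemma is_derive_Rconst (c t : R) : is_derive (fun _ => c) t 0.
Proof. exact (is_derive_const c t). Qed.

Lemma is_derive_Rscal (f : R -> R) (c t a : R) :
  is_derive f t a -> is_derive (fun s => c * f s) t (c * a).
Proof. intros Hf. exact (is_derive_scal f t c a Hf). Qed.

Lemma is_derive_Rsqr (f : R -> R) (t a : R) :
  is_derive f t a -> is_derive (fun s => f s ^ 2) t (2 * f t * a).
Proof.
intros Hf. eapply is_derive_val.
- apply (is_derive_ext (fun s => f s * f s)); [intros s; change (@eq R (f s * f s) (f s ^ 2)); ring|].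
  apply (is_derive_Rmult f f t a a Hf Hf).
- ring.
Qed.

Lemma is_derive_exp_lin (c t : R) : is_derive (fun s => exp (c * s)) t (c * exp (c * t)).
Proof. auto_derive; [easy|ring]. Qed.

Lemma is_derive_Rcomp (f g : R -> R) (t a b : R) :
  is_derive f (g t) a -> is_derive g t b -> is_derive (fun s => f (g s)) t (a * b).
Proof.
intros Hf Hg. eapply is_derive_val; [exact (is_derive_comp f g t a b Hf Hg)|].
unfold scal; simpl; unfold mult; simpl; ring.
Qed.

Lemma is_derive_exp_affine (c a t : R) :
  is_derive (fun s => exp (c * (s - a))) t (c * exp (c * (t - a))).
Proof.
eapply is_derive_val.
- apply (is_derive_Rcomp exp (fun s => c * (s - a)) t (exp (c * (t - a))) (c * (1 - 0))).
  + apply is_derive_exp.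
  + apply (is_derive_Rscal (fun s => s - a)), is_derive_Rminus;
      [exact (is_derive_id t)|apply is_derive_Rconst].
- ring.
Qed.

(** A continuous induction on decreasing t: the least upper bound of the bad set
cannot itself be bad, and openness of g < 0 then moves the bound down. *)
Lemma backward_continuation (g : R -> R) (N T : R) :
  (forall t, T <= t <= N -> continuous g t) -> g N < 0 ->
  (forall t, T <= t < N -> (forall s, t < s <= N -> g s < 0) -> g t < 0) ->
  forall t, T <= t <= N -> g t < 0.
Proof.
intros Hc HN Hs t Ht.
apply Rnot_le_lt; intros Hbad.
pose (E := fun s => t <= s <= N /\ 0 <= g s).
destruct (completeness E) as [x [Hub Hlub]].
- exists N. intros s [Hs1 _]. lra.
- exists t. split; [lra|exact Hbad].
- assert (Htx : t <= x) by (apply Hub; split; [lra|exact Hbad]).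
  assert (HxN : x <= N) by (apply Hlub; intros s [Hs1 _]; lra).
  assert (Habove : forall s, x < s <= N -> g s < 0).
  { intros s Hsx. apply Rnot_le_lt; intros Hg.
    assert (s <= x) by (apply Hub; split; [lra|exact Hg]). lra. }
  assert (Hgx : g x < 0).
  { destruct (Req_dec x N) as [->|Hne]; [exact HN|].
    apply Hs; [lra|exact Habove]. }
  destruct (proj1 (continuous_eps g x) (Hc x ltac:(lra)) (- g x)) as [d [Hd0 Hd]]; [lra|].
  assert (Hub' : x <= x - d).
  { apply Hlub. intros s [Hs1 Hs2].
    apply Rnot_lt_le; intros Hds.
    assert (s <= x) by (apply Hub; split; assumption).
    assert (Rabs (s - x) < d) by (apply Rabs_def1; lra).
    assert (H1 := Hd s H0). apply Rabs_def2 in H1. lra. }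
  lra.
Qed.

Lemma Rpower_pos x y : 0 < Rpower x y.
Proof. apply exp_pos. Qed.

Lemma Rpower_mult_base x P : 0 < x -> Rpower x P = x * Rpower x (P - 1).
Proof.
intros Hx. rewrite <- (Rpower_1 x Hx) at 2. rewrite <- Rpower_plus. f_equal; ring.
Qed.

Lemma is_derive_Rpower (y : R -> R) (P t dy : R) :
  0 < y t -> is_derive y t dy ->
  is_derive (fun s => Rpower (y s) P) t (P * Rpower (y t) (P - 1) * dy).
Proof.
intros Hy Hd. assert (Hd' : is_derive (fun x => Rpower x P) (y t) (P * Rpower (y t) (P - 1))).
{ apply is_derive_Reals. apply derivable_pt_lim_power. exact Hy. }
exact (is_derive_Rcomp (fun x => Rpower x P) y t _ _ Hd' Hd).
Qed.

Lemma Rpower_le_base x y P : 0 <= P -> 0 < x -> x <= y -> Rpower x P <= Rpower y P.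
Proof. intros HP Hx Hxy. apply Rle_Rpower_l; lra. Qed.

Lemma Rpower_lt_base x y P : 0 < P -> 0 < x -> x < y -> Rpower x P < Rpower y P.
Proof.
intros HP Hx Hxy. apply exp_increasing, Rmult_lt_compat_l; [exact HP|].
now apply ln_increasing.
Qed.

Lemma Rpower_inv_base x P : 0 < P -> 0 < x -> Rpower (Rpower x (/ P)) P = x.
Proof. intros HP Hx. rewrite Rpower_mult, Rinv_l by lra. now apply Rpower_1. Qed.

Lemma Rpower_mean_value x y P :
  0 < x -> 0 < y ->
  exists c, Rmin x y <= c <= Rmax x y /\
            Rpower x P - Rpower y P = P * Rpower c (P - 1) * (x - y).
Proof.
assert (main : forall x y, 0 < x -> x <= y -> exists c, x <= c <= y /\
            Rpower y P - Rpower x P = P * Rpower c (P - 1) * (y - x)).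
{ intros a b Ha Hab.
  apply (mean_value (fun t => Rpower t P) (fun t => P * Rpower t (P - 1)) a b Hab).
  intros t Ht. apply is_derive_Reals, derivable_pt_lim_power. lra. }
intros Hx Hy. destruct (Rle_lt_dec x y) as [H|H].
- destruct (main x y Hx H) as [c [Hc He]]. exists c.
  rewrite Rmin_left, Rmax_right by lra. split; [exact Hc|lra].
- destruct (main y x Hy ltac:(lra)) as [c [Hc He]]. exists c.
  rewrite Rmin_right, Rmax_left by lra. split; [exact Hc|lra].
Qed.

Lemma Rpower_lipschitz x y M P :
  1 < P -> 0 < x <= M -> 0 < y <= M ->
  Rabs (Rpower x P - Rpower y P) <= P * Rpower M (P - 1) * Rabs (x - y).
Proof.
intros HP Hx Hy.
destruct (Rpower_mean_value x y P) as [c [Hc ->]]; [lra|lra|].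
assert (0 < c) by (apply Rlt_le_trans with (Rmin x y); [apply Rmin_glb_lt; lra|lra]).
assert (c <= M) by (apply Rle_trans with (Rmax x y); [lra|apply Rmax_lub; lra]).
rewrite Rabs_mult. apply Rmult_le_compat_r; [apply Rabs_pos|].
assert (H1 := Rpower_pos c (P - 1)).
rewrite Rabs_pos_eq by nra.
apply Rmult_le_compat_l; [lra|]. apply Rpower_le_base; lra.
Qed.

(** The squared norm of (phi, psi) satisfies |N'| <= (1 + 3 L) N; both time
directions are needed, one to continue forward and one to continue backward. *)
Lemma gronwall (phi psi chi : R -> R) (L a b : R) :
  0 <= L -> a <= b ->
  (forall t, a <= t <= b -> is_derive phi t (psi t) /\ is_derive psi t (chi t) /\
     Rabs (chi t) <= L * (Rabs (phi t) + Rabs (psi t))) ->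
  (phi b ^ 2 + psi b ^ 2 <= (phi a ^ 2 + psi a ^ 2) * exp ((1 + 3 * L) * (b - a))) /\
  (phi a ^ 2 + psi a ^ 2 <= (phi b ^ 2 + psi b ^ 2) * exp ((1 + 3 * L) * (b - a))).
Proof.
intros HL Hab H.
set (C := 1 + 3 * L).
set (N := fun t => phi t ^ 2 + psi t ^ 2).
set (dN := fun t => 2 * phi t * psi t + 2 * psi t * chi t).
assert (HdN : forall t, a <= t <= b -> is_derive N t (dN t)).
{ intros t Ht. destruct (H t Ht) as [H1 [H2 _]].
  exact (is_derive_Rplus _ _ _ _ _ (is_derive_Rsqr _ _ _ H1) (is_derive_Rsqr _ _ _ H2)). }
assert (Hb : forall t, a <= t <= b -> Rabs (dN t) <= C * N t).
{ intros t Ht. destruct (H t Ht) as [_ [_ H3]]. unfold dN, N, C.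
  assert (E1 : phi t ^ 2 = Rabs (phi t) ^ 2) by (rewrite <- !Rsqr_pow2; apply Rsqr_abs).
  assert (E2 : psi t ^ 2 = Rabs (psi t) ^ 2) by (rewrite <- !Rsqr_pow2; apply Rsqr_abs).
  rewrite E1, E2.
  assert (P1 := Rabs_pos (phi t)). assert (P2 := Rabs_pos (psi t)).
  eapply Rle_trans; [apply Rabs_triang|].
  rewrite !Rabs_mult, (Rabs_pos_eq 2) by lra.
  set (x := Rabs (phi t)) in *. set (y := Rabs (psi t)) in *. set (z := Rabs (chi t)) in *.
  assert (2 * y * z <= 2 * y * (L * (x + y))) by (apply Rmult_le_compat_l; nra).
  assert (0 <= (x - y) ^ 2) by apply pow2_ge_0.
  assert (0 <= L * (x - y) ^ 2) by (apply Rmult_le_pos; lra).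
  assert (0 <= L * x ^ 2) by (apply Rmult_le_pos; [lra|apply pow2_ge_0]). nra. }
assert (Hprod : forall c t, a <= t <= b ->
   is_derive (fun s => N s * exp (c * (s - a))) t ((dN t + c * N t) * exp (c * (t - a)))).
{ intros c t Ht.
  replace ((dN t + c * N t) * exp (c * (t - a))) with
   (dN t * exp (c * (t - a)) + N t * (c * exp (c * (t - a)))) by ring.
  apply (is_derive_mult N (fun s => exp (c * (s - a)))); [now apply HdN|apply is_derive_exp_affine|].
  intros; apply Rmult_comm. }
split; fold (N a); fold (N b).
- assert (Hm : - (N a * exp (- C * (a - a))) <= - (N b * exp (- C * (b - a)))).
  { apply (nondecreasing_of_derive (fun s => - (N s * exp (- C * (s - a))))
      (fun t => - ((dN t + - C * N t) * exp (- C * (t - a)))) a b Hab).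
    - intros t Ht. apply (is_derive_opp (fun s => N s * exp (- C * (s - a)))). now apply Hprod.
    - intros t Ht. assert (H1 := Hb t Ht). apply Rabs_le_between in H1.
      assert (H2 := exp_pos (- C * (t - a))). nra. }
  replace (- C * (a - a)) with 0 in Hm by ring. rewrite exp_0 in Hm.
  replace (- C * (b - a)) with (- (C * (b - a))) in Hm by ring. rewrite exp_Ropp in Hm.
  assert (H2 := exp_pos (C * (b - a))).
  assert (N b * / exp (C * (b - a)) <= N a) by lra.
  apply Rmult_le_compat_r with (r := exp (C * (b - a))) in H0; [|lra].
  rewrite Rmult_assoc, Rinv_l in H0 by lra. lra.
- assert (Hm : N a * exp (C * (a - a)) <= N b * exp (C * (b - a))).
  { apply (nondecreasing_of_derive (fun s => N s * exp (C * (s - a)))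
      (fun t => (dN t + C * N t) * exp (C * (t - a))) a b Hab).
    - intros t Ht. now apply Hprod.
    - intros t Ht. assert (H1 := Hb t Ht). apply Rabs_le_between in H1.
      assert (H2 := exp_pos (C * (t - a))). nra. }
  replace (C * (a - a)) with 0 in Hm by ring. rewrite exp_0 in Hm. lra.
Qed.

(** * Global solutions of second-order initial value problems *)

(** The weight exp (M |t - t0|) is gained back with a factor 1 / M by
integration; with M large this makes a Picard step contract. *)
Lemma primitive_exp_bound (H h : R -> R) (t0 rho K M : R) :
  0 < M -> 0 <= K -> H t0 = 0 ->
  (forall t, Rabs (t - t0) <= rho ->
     is_derive H t (h t) /\ Rabs (h t) <= K * exp (M * Rabs (t - t0))) ->
  forall t, Rabs (t - t0) <= rho -> Rabs (H t) <= K / M * exp (M * Rabs (t - t0)).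
Proof.
intros HM HK H0 Hd.
assert (HKM : 0 <= K / M) by (apply Rmult_le_pos; [lra|apply Rlt_le, Rinv_0_lt_compat; lra]).
assert (HKM' : K / M * M = K) by (field; lra).
assert (upper : forall H h : R -> R, H t0 = 0 ->
  (forall t, Rabs (t - t0) <= rho ->
     is_derive H t (h t) /\ Rabs (h t) <= K * exp (M * Rabs (t - t0))) ->
  forall t, Rabs (t - t0) <= rho -> H t <= K / M * exp (M * Rabs (t - t0))).
{ clear H h H0 Hd. intros H h H0 Hd t Ht.
  destruct (Rle_lt_dec t0 t) as [Hle|Hlt].
  - rewrite (Rabs_pos_eq (t - t0)) in * by lra.
    assert (H1 := nondecreasing_of_derive (fun s => K / M * exp (M * (s - t0)) - H s)
      (fun s => K / M * (M * exp (M * (s - t0))) - h s) t0 t Hle).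
    cbv beta in H1. rewrite H0, Rminus_diag, Rmult_0_r, exp_0 in H1.
    enough (K / M * 1 - 0 <= K / M * exp (M * (t - t0)) - H t) by lra.
    apply H1; intros s Hst; destruct (Hd s) as [Hs Hb]; try (rewrite Rabs_pos_eq; lra).
    + apply is_derive_Rminus; [apply is_derive_Rscal, is_derive_exp_affine|exact Hs].
    + rewrite (Rabs_pos_eq (s - t0)) in Hb by lra. apply Rabs_le_between in Hb.
      rewrite <- Rmult_assoc, HKM'. lra.
  - rewrite (Rabs_left (t - t0)) in * by lra.
    replace (M * - (t - t0)) with (- M * (t - t0)) by ring.
    assert (H1 := nondecreasing_of_derive (fun s => - (K / M * exp (- M * (s - t0))) + H s)
      (fun s => - (K / M * (- M * exp (- M * (s - t0)))) + h s) t t0 ltac:(lra)).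
    cbv beta in H1. rewrite H0, Rminus_diag, Rmult_0_r, exp_0 in H1.
    enough (- (K / M * exp (- M * (t - t0))) + H t <= - (K / M * 1) + 0) by lra.
    apply H1; intros s Hst; destruct (Hd s) as [Hs Hb]; try (rewrite Rabs_left1; lra).
    + apply is_derive_Rplus; [apply is_derive_Ropp, is_derive_Rscal, is_derive_exp_affine|exact Hs].
    + rewrite (Rabs_left1 (s - t0)) in Hb by lra. apply Rabs_le_between in Hb.
      replace (M * - (s - t0)) with (- M * (s - t0)) in Hb by ring.
      replace (- (K / M * (- M * exp (- M * (s - t0))))) with (K / M * M * exp (- M * (s - t0))) by ring.
      rewrite HKM'. lra. }
intros t Ht. apply Rabs_le; split; [|now apply (upper H h)].
enough (- H t <= K / M * exp (M * Rabs (t - t0))) by lra.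
apply (upper (fun s => - H s) (fun s => - h s)); [lra| |exact Ht].
intros s Hs. destruct (Hd s Hs) as [H1 H2]. split; [now apply is_derive_Ropp|now rewrite Rabs_Ropp].
Qed.

Lemma is_derive_primitive (f : R -> R) (c t0 t : R) :
  (forall s, continuous f s) -> is_derive (fun s => c + RInt f t0 s) t (f t).
Proof.
intros Hf. eapply is_derive_val.
- apply is_derive_Rplus; [apply is_derive_Rconst|].
  apply (is_derive_RInt f (RInt f t0) t0 t); [|apply Hf].
  apply filter_forall. intros b. apply (RInt_correct f), (ex_RInt_continuous f).
  intros z _. apply Hf.
- apply Rplus_0_l.
Qed.

Lemma is_lim_seq_half_pow (C : R) : is_lim_seq (fun n => C * / 2 ^ n) 0.
Proof.
replace (Finite 0) with (Rbar_mult C 0) by (simpl; f_equal; ring).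
apply (is_lim_seq_scal_l (fun n => / 2 ^ n) C 0).
apply (is_lim_seq_ext (fun n => (/ 2) ^ n)); [intros n; now rewrite pow_inv|].
apply is_lim_seq_geom. rewrite Rabs_pos_eq; lra.
Qed.

Lemma geometric_limit (u : nat -> R) (C : R) :
  (forall n, Rabs (u (S n) - u n) <= C * / 2 ^ n) ->
  forall n, Rabs (u n - real (Lim_seq u)) <= 2 * C * / 2 ^ n.
Proof.
intros Hu.
assert (Hpos : forall n, 0 < / 2 ^ n) by (intros n; apply Rinv_0_lt_compat, pow_lt; lra).
assert (Hhalf : forall n, / 2 ^ S n = / 2 ^ n / 2).
{ intros n. simpl. rewrite Rinv_mult. field. apply pow_nonzero; lra. }
assert (HC : 0 <= C).
{ assert (H := Hu O). assert (H1 := Rabs_pos (u 1%nat - u O)). simpl in H. lra. }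
assert (Hk : forall n k, Rabs (u (n + k)%nat - u n) <= 2 * C * (/ 2 ^ n - / 2 ^ (n + k))).
{ intros n k. induction k as [|k IH].
  - rewrite Nat.add_0_r, !Rminus_diag, Rabs_R0. lra.
  - rewrite Nat.add_succ_r, Hhalf.
    replace (u (S (n + k)) - u n) with ((u (S (n + k)) - u (n + k)%nat) + (u (n + k)%nat - u n)) by ring.
    eapply Rle_trans; [apply Rabs_triang|].
    assert (H := Hu (n + k)%nat). lra. }
assert (Hk' : forall n k, Rabs (u (n + k)%nat - u n) <= 2 * C * / 2 ^ n).
{ intros n k. eapply Rle_trans; [apply Hk|]. assert (H := Hpos (n + k)%nat). nra. }
assert (Hlim := is_lim_seq_half_pow (2 * C)).
assert (Hcv : ex_finite_lim_seq u).
{ apply ex_lim_seq_cauchy_corr. intros eps.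
  apply is_lim_seq_spec in Hlim. destruct (Hlim (pos_div_2 eps)) as [N HN].
  exists N. intros a b Ha Hb.
  specialize (HN N (le_n N)). rewrite Rminus_0_r, Rabs_pos_eq in HN.
  2:{ assert (H := Hpos N). nra. }
  simpl in HN.
  assert (H1 := Hk' N (a - N)%nat). assert (H2 := Hk' N (b - N)%nat).
  replace (N + (a - N))%nat with a in H1 by lia. replace (N + (b - N))%nat with b in H2 by lia.
  replace (u a - u b) with ((u a - u N) - (u b - u N)) by ring.
  eapply Rle_lt_trans; [apply Rabs_triang|]. rewrite Rabs_Ropp. lra. }
destruct Hcv as [l Hl]. rewrite (is_lim_seq_unique _ _ Hl). simpl.
intros n. rewrite Rabs_minus_sym.
apply (is_lim_seq_le (fun k => Rabs (u (k + n)%nat - u n)) (fun _ => 2 * C * / 2 ^ n)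
   (Rabs (l - u n)) (2 * C * / 2 ^ n)).
- intros k. rewrite Nat.add_comm. apply Hk'.
- apply (is_lim_seq_abs (fun k => u (k + n)%nat - u n) (l - u n)).
  apply (is_lim_seq_minus' (fun k => u (k + n)%nat) (fun _ => u n) l (u n));
    [|apply is_lim_seq_const].
  now apply is_lim_seq_incr_n.
- apply is_lim_seq_const.
Qed.

Lemma continuous_bounded (f : R -> R) (a b : R) :
  a <= b -> (forall t, continuous f t) -> exists C, 0 <= C /\ forall t, a <= t <= b -> Rabs (f t) <= C.
Proof.
intros Hab Hf.
destruct (continuity_ab_maj (fun t => Rabs (f t)) a b Hab) as [x [Hx _]].
- intros c _. apply continuity_pt_filterlim.
  apply (continuous_comp f Rabs); [apply Hf|apply continuous_Rabs].
- exists (Rabs (f x)). split; [apply Rabs_pos|exact Hx].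
Qed.

Lemma zero_of_geometric_bound (x C : R) : (forall n, Rabs x <= C * / 2 ^ n) -> x = 0.
Proof.
intros H. assert (Hlim := is_lim_seq_half_pow C).
assert (H1 : Rabs x <= 0).
{ apply (is_lim_seq_le (fun _ => Rabs x) (fun n => C * / 2 ^ n) (Rabs x) 0);
   [exact H|apply is_lim_seq_const|exact Hlim]. }
assert (H2 := Rabs_pos x).
destruct (Req_dec x 0) as [|Hne]; [assumption|]. apply Rabs_pos_lt in Hne. lra.
Qed.

Fixpoint picard (G : R -> R -> R -> R) (t0 x0 v0 : R) (n : nat) : (R -> R) * (R -> R) :=
  match n with
  | O => (fun _ => x0, fun _ => v0)
  | S m => let p := picard G t0 x0 v0 m in
      (fun t => x0 + RInt (snd p) t0 t,
       fun t => v0 + RInt (fun s => G s (fst p s) (snd p s)) t0 t)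
  end.

(** A Lipschitz constant that is uniform on each bounded time interval rules out
blow-up, so the iterates converge on every such interval and the solution is
defined for all times. *)
Lemma global_solution (G : R -> R -> R -> R) (t0 x0 v0 : R) :
  (forall x v : R -> R, (forall t, continuous x t) -> (forall t, continuous v t) ->
     forall t, continuous (fun s => G s (x s) (v s)) t) ->
  (forall rho, exists L, 0 <= L /\ forall t x v x' v', Rabs (t - t0) <= rho ->
     Rabs (G t x v - G t x' v') <= L * (Rabs (x - x') + Rabs (v - v'))) ->
  exists x v : R -> R, x t0 = x0 /\ v t0 = v0 /\
    forall t, is_derive x t (v t) /\ is_derive v t (G t (x t) (v t)).
Proof.
intros Hcont Hlip.
set (X := fun n => fst (picard G t0 x0 v0 n)).
set (V := fun n => snd (picard G t0 x0 v0 n)).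
assert (HXV : forall n, (forall t, continuous (X n) t) /\ (forall t, continuous (V n) t) /\
   (forall t, is_derive (X (S n)) t (V n t)) /\
   (forall t, is_derive (V (S n)) t (G t (X n t) (V n t)))).
{ assert (Hstep : forall n, (forall t, continuous (X n) t) -> (forall t, continuous (V n) t) ->
    (forall t, is_derive (X (S n)) t (V n t)) /\
    (forall t, is_derive (V (S n)) t (G t (X n t) (V n t)))).
  { intros n HX HV. split; intros t.
    - apply (is_derive_primitive (V n) x0 t0 t HV).
    - apply (is_derive_primitive (fun s => G s (X n s) (V n s)) v0 t0 t).
      now apply Hcont. }
  induction n as [|n [IH1 [IH2 [IH3 IH4]]]].
  - assert (H1 : forall t, continuous (X O) t) by (intros t; apply continuous_const).
    assert (H2 : forall t, continuous (V O) t) by (intros t; apply continuous_const).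
    exact (conj H1 (conj H2 (Hstep O H1 H2))).
  - assert (H1 : forall t, continuous (X (S n)) t)
      by (intros t; apply (is_derive_continuous _ _ _ (IH3 t))).
    assert (H2 : forall t, continuous (V (S n)) t)
      by (intros t; apply (is_derive_continuous _ _ _ (IH4 t))).
    exact (conj H1 (conj H2 (Hstep (S n) H1 H2))). }
assert (HX0 : forall n, X n t0 = x0 /\ V n t0 = v0).
{ intros [|n]; [split; reflexivity|]. unfold X, V; simpl.
  rewrite !RInt_point. unfold zero; simpl. split; ring. }
set (x := fun t => real (Lim_seq (fun n => X n t))).
set (v := fun t => real (Lim_seq (fun n => V n t))).
(* The weight exp (M |t - t0|) makes each Picard step a contraction of factor 1/2. *)
assert (Hunif : forall rho, 0 <= rho -> exists C, 0 <= C /\ forall n t, Rabs (t - t0) <= rho ->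
   Rabs (X n t - x t) <= C * / 2 ^ n /\ Rabs (V n t - v t) <= C * / 2 ^ n).
{ intros rho Hrho. destruct (Hlip rho) as [L [HL HG]].
  set (M := 2 * (1 + L)).
  destruct (continuous_bounded (fun t => Rabs (X 1%nat t - X O t) + Rabs (V 1%nat t - V O t))
     (t0 - rho) (t0 + rho)) as [C0 [HC0 HB0]]; [lra| |].
  { intros t. destruct (HXV O) as [a1 [a2 _]]. destruct (HXV 1%nat) as [a3 [a4 _]].
    apply continuous_Rplus; apply (continuous_comp _ Rabs); try apply continuous_Rabs;
      now apply continuous_Rminus. }
  assert (Hdiff : forall n t, Rabs (t - t0) <= rho ->
     Rabs (X (S n) t - X n t) + Rabs (V (S n) t - V n t) <= C0 * / 2 ^ n * exp (M * Rabs (t - t0))).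
  { induction n as [|n IH]; intros t Ht.
    - apply Rle_trans with C0.
      + eapply Rle_trans; [apply Rle_abs|]. apply HB0. apply Rabs_le_between in Ht. lra.
      + simpl. rewrite Rinv_1, Rmult_1_r. rewrite <- (Rmult_1_r C0) at 1.
        apply Rmult_le_compat_l; [exact HC0|].
        assert (H := exp_ineq1_le (M * Rabs (t - t0))).
        assert (H1 : 0 <= M * Rabs (t - t0)) by (apply Rmult_le_pos; [unfold M; lra|apply Rabs_pos]).
        lra.
    - set (K := C0 * / 2 ^ n).
      assert (HK : 0 <= K).
      { apply Rmult_le_pos; [lra|]. apply Rlt_le, Rinv_0_lt_compat, pow_lt; lra. }
      assert (HM : 0 < M) by (unfold M; lra).
      destruct (HXV n) as [_ [_ [a1 a2]]]. destruct (HXV (S n)) as [_ [_ [a3 a4]]].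
      assert (B1 : Rabs (X (S (S n)) t - X (S n) t) <= K / M * exp (M * Rabs (t - t0))).
      { apply (primitive_exp_bound (fun t => X (S (S n)) t - X (S n) t)
          (fun t => V (S n) t - V n t) t0 rho K M); try assumption.
        - rewrite (proj1 (HX0 _)), (proj1 (HX0 _)). ring.
        - intros s Hs. split; [apply is_derive_Rminus; auto|].
          assert (H := IH s Hs). fold K in H.
          assert (H1 := Rabs_pos (X (S n) s - X n s)). lra. }
      assert (B2 : Rabs (V (S (S n)) t - V (S n) t) <= (L * K) / M * exp (M * Rabs (t - t0))).
      { apply (primitive_exp_bound (fun t => V (S (S n)) t - V (S n) t)
          (fun t => G t (X (S n) t) (V (S n) t) - G t (X n t) (V n t)) t0 rho (L * K) M); try assumption.
        - apply Rmult_le_pos; lra.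
        - rewrite (proj2 (HX0 _)), (proj2 (HX0 _)). ring.
        - intros s Hs. split; [apply is_derive_Rminus; auto|].
          eapply Rle_trans; [apply HG, Hs|]. rewrite Rmult_assoc.
          apply Rmult_le_compat_l; [exact HL|]. apply IH, Hs. }
      replace (C0 * / 2 ^ S n) with (K / M + L * K / M).
      + lra.
      + unfold K, M. simpl. field. split; [apply pow_nonzero; lra|lra]. }
  set (C := C0 * exp (M * rho)).
  assert (HC : 0 <= C) by (apply Rmult_le_pos; [lra|apply Rlt_le, exp_pos]).
  assert (Hdiff' : forall t, Rabs (t - t0) <= rho -> forall n,
     Rabs (X (S n) t - X n t) <= C * / 2 ^ n /\ Rabs (V (S n) t - V n t) <= C * / 2 ^ n).
  { intros t Ht n. assert (H := Hdiff n t Ht).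
    assert (H1 := Rabs_pos (X (S n) t - X n t)). assert (H2 := Rabs_pos (V (S n) t - V n t)).
    assert (H3 : exp (M * Rabs (t - t0)) <= exp (M * rho)).
    { destruct (Rle_lt_or_eq_dec (M * Rabs (t - t0)) (M * rho)) as [Hl|He].
      - apply Rmult_le_compat_l; [unfold M; lra|exact Ht].
      - apply Rlt_le, exp_increasing, Hl.
      - rewrite He. lra. }
    assert (H4 : C0 * / 2 ^ n * exp (M * Rabs (t - t0)) <= C * / 2 ^ n).
    { unfold C. replace (C0 * exp (M * rho) * / 2 ^ n) with (C0 * / 2 ^ n * exp (M * rho)) by ring.
      apply Rmult_le_compat_l; [|exact H3].
      apply Rmult_le_pos; [lra|]. apply Rlt_le, Rinv_0_lt_compat, pow_lt; lra. }
    split; lra. }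
  exists (2 * C). split; [lra|]. intros n t Ht. split.
  - apply (geometric_limit (fun n => X n t)). intros m. now apply Hdiff'.
  - apply (geometric_limit (fun n => V n t)). intros m. now apply Hdiff'. }
assert (Hlimcont : forall (F : nat -> R -> R) (f : R -> R),
   (forall n t, continuous (F n) t) ->
   (forall rho, 0 <= rho -> exists C, 0 <= C /\ forall n t, Rabs (t - t0) <= rho -> Rabs (F n t - f t) <= C * / 2 ^ n) ->
   forall t, continuous f t).
{ intros F f HF Hu t. apply continuous_eps. intros eps Heps.
  destruct (Hu (Rabs (t - t0) + 1)) as [C [HC HB]]; [assert (H := Rabs_pos (t - t0)); lra|].
  assert (Hn : exists n, C * / 2 ^ n < eps / 3).
  { assert (Hlim := is_lim_seq_half_pow C).
    apply is_lim_seq_spec in Hlim. destruct (Hlim (mkposreal (eps / 3) ltac:(lra))) as [N HN].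
    exists N. specialize (HN N (le_n N)). simpl in HN. apply Rabs_def2 in HN. lra. }
  destruct Hn as [n Hn].
  destruct (proj1 (continuous_eps (F n) t) (HF n t) (eps / 3)) as [d [Hd0 Hd]]; [lra|].
  exists (Rmin d 1). split; [apply Rmin_glb_lt; lra|].
  intros s Hs.
  assert (Hs1 : Rabs (s - t) < d) by (eapply Rlt_le_trans; [exact Hs|apply Rmin_l]).
  assert (Hs2 : Rabs (s - t) < 1) by (eapply Rlt_le_trans; [exact Hs|apply Rmin_r]).
  assert (Hs3 : Rabs (s - t0) <= Rabs (t - t0) + 1).
  { replace (s - t0) with ((s - t) + (t - t0)) by ring.
    eapply Rle_trans; [apply Rabs_triang|]. lra. }
  assert (B1 := HB n s Hs3). assert (B2 := HB n t ltac:(lra)). assert (B3 := Hd s Hs1).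
  replace (f s - f t) with (- (F n s - f s) + (F n s - F n t) + (F n t - f t)) by ring.
  eapply Rle_lt_trans; [apply Rabs_triang|].
  assert (B4 := Rabs_triang (- (F n s - f s)) (F n s - F n t)).
  rewrite Rabs_Ropp in B4. lra. }
assert (Hx : forall t, continuous x t).
{ apply (Hlimcont X); [intros n; apply HXV|]. intros rho Hr.
  destruct (Hunif rho Hr) as [C [HC HB]]. exists C. split; [exact HC|]. intros n t Ht. now apply HB. }
assert (Hv : forall t, continuous v t).
{ apply (Hlimcont V); [intros n; apply HXV|]. intros rho Hr.
  destruct (Hunif rho Hr) as [C [HC HB]]. exists C. split; [exact HC|]. intros n t Ht. now apply HB. }
assert (Hg : forall t, continuous (fun s => G s (x s) (v s)) t) by (now apply Hcont).
(* Both components of the scheme are primitives, so one passage to the limit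
   serves for the two integral equations. *)
assert (Hint : forall (F f : nat -> R -> R) (y g : R -> R) (c : R),
   (forall n, F (S n) t0 = c) -> (forall n t, is_derive (F (S n)) t (f n t)) ->
   (forall t, continuous g t) ->
   (forall rho, 0 <= rho -> exists C, 0 <= C /\ forall n t, Rabs (t - t0) <= rho ->
      Rabs (F n t - y t) <= C * / 2 ^ n /\ Rabs (f n t - g t) <= C * / 2 ^ n) ->
   forall t, y t = c + RInt g t0 t).
{ intros F f y g c HF0 HF Hgc Hu t.
  destruct (Hu (Rabs (t - t0)) (Rabs_pos _)) as [C [HC HB]].
  apply Rminus_diag_uniq.
  apply (zero_of_geometric_bound _ (C + C * exp (Rabs (t - t0)))). intros n.
  assert (Hpos : 0 < / 2 ^ n) by (apply Rinv_0_lt_compat, pow_lt; lra).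
  assert (B1 : Rabs (F (S n) t - (c + RInt g t0 t)) <= (C * / 2 ^ n) / 1 * exp (1 * Rabs (t - t0))).
  { apply (primitive_exp_bound (fun t => F (S n) t - (c + RInt g t0 t)) (fun t => f n t - g t)
      t0 (Rabs (t - t0)) (C * / 2 ^ n) 1); [lra|apply Rmult_le_pos; lra| | |lra].
    - rewrite HF0, RInt_point. unfold zero; simpl. ring.
    - intros s Hs. split.
      + apply is_derive_Rminus; [apply HF|now apply is_derive_primitive].
      + destruct (HB n s Hs) as [_ H]. eapply Rle_trans; [exact H|].
        rewrite <- (Rmult_1_r (C * / 2 ^ n)) at 1.
        apply Rmult_le_compat_l; [apply Rmult_le_pos; lra|].
        assert (H1 := exp_ineq1_le (1 * Rabs (s - t0))). assert (H2 := Rabs_pos (s - t0)). lra. }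
  destruct (HB (S n) t (Rle_refl _)) as [B2 _].
  rewrite Rmult_1_l in B1.
  assert (B3 : / 2 ^ S n <= / 2 ^ n).
  { simpl. rewrite Rinv_mult. lra. }
  assert (B4 := Rmult_le_compat_l C _ _ HC B3).
  replace (y t - (c + RInt g t0 t)) with (- (F (S n) t - y t) + (F (S n) t - (c + RInt g t0 t))) by ring.
  eapply Rle_trans; [apply Rabs_triang|]. rewrite Rabs_Ropp. lra. }
assert (Ex : forall t, x t = x0 + RInt v t0 t).
{ apply (Hint X V); [intros n; apply HX0|intros n; apply HXV|exact Hv|exact Hunif]. }
assert (Ev : forall t, v t = v0 + RInt (fun s => G s (x s) (v s)) t0 t).
{ apply (Hint V (fun n t => G t (X n t) (V n t)));
    [intros n; apply HX0|intros n; apply HXV|exact Hg|].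
  intros rho Hr. destruct (Hunif rho Hr) as [C [HC HB]]. destruct (Hlip rho) as [L [HL HG]].
  exists (C + L * (C + C)). split; [nra|]. intros n t Ht. destruct (HB n t Ht) as [B1 B2].
  assert (Hpos : 0 < / 2 ^ n) by (apply Rinv_0_lt_compat, pow_lt; lra).
  assert (HLC : 0 <= L * (C + C)) by nra.
  split; [nra|].
  eapply Rle_trans; [apply HG, Ht|].
  apply Rle_trans with (L * (C * / 2 ^ n + C * / 2 ^ n)); [apply Rmult_le_compat_l; lra|].
  assert (0 <= C * / 2 ^ n) by (apply Rmult_le_pos; lra). nra. }
exists x, v. split; [|split].
- rewrite Ex, RInt_point. unfold zero; simpl. ring.
- rewrite Ev, RInt_point. unfold zero; simpl. ring.
- intros t. split.
  + apply (is_derive_ext (fun s => x0 + RInt v t0 s)); [intros s; symmetry; apply Ex|].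
    now apply is_derive_primitive.
  + apply (is_derive_ext (fun s => v0 + RInt (fun s => G s (x s) (v s)) t0 s));
      [intros s; symmetry; apply Ev|].
    exact (is_derive_primitive (fun s => G s (x s) (v s)) v0 t0 t Hg).
Qed.

(** * The equation in logarithmic time *)

(** The parameters are the roots a and - b of the linear part, rather than its
coefficients, because exponential rescaling and time reversal act simply on
them.  The exponents mu and nu have opposite sign conventions so that time
reversal exchanges (a, mu, P) and (b, nu, Q). *)
Definition solves_at (a b mu nu P Q : R) (y v : R -> R) (t : R) : Prop :=
  0 < y t /\ is_derive y t (v t) /\
  is_derive v t ((a - b) * v t + a * b * y t
                 - exp (mu * t) * Rpower (y t) P - exp (- nu * t) * Rpower (y t) Q).

Definition solves (a b mu nu P Q : R) (y v : R -> R) : Prop :=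
  forall t, solves_at a b mu nu P Q y v t.

(** Nonnegative thresholds T make several of them combine by addition. *)
Definition tends_to (f : R -> R) (l : R) : Prop :=
  forall eps, 0 < eps -> exists T, 0 <= T /\ forall t, T <= t -> Rabs (f t - l) < eps.

Lemma Rpower_exp_mult (s x P : R) : 0 < x -> Rpower (exp s * x) P = exp (P * s) * Rpower x P.
Proof.
intros Hx. rewrite <- Rpower_mult_distr by (try apply exp_pos; assumption).
f_equal. unfold Rpower. now rewrite ln_exp.
Qed.

(** Multiplication of the unknown by exp (- th t) translates both roots of the
linear part by th, which keeps the shape of the equation. *)
Lemma solves_at_shift (th a b mu nu P Q : R) (y v : R -> R) (t : R) :
  solves_at a b mu nu P Q y v t ->
  solves_at (a - th) (b + th) (mu + (P - 1) * th) (nu - (Q - 1) * th) P Q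
    (fun s => exp (- th * s) * y s) (fun s => exp (- th * s) * (v s - th * y s)) t.
Proof.
intros [Hy [Hd1 Hd2]]. unfold solves_at.
assert (He := is_derive_exp_lin (- th) t).
split; [|split].
- apply Rmult_lt_0_compat; [apply exp_pos|exact Hy].
- eapply is_derive_val; [apply is_derive_Rmult; [exact He|exact Hd1]|]. cbv beta. ring.
- eapply is_derive_val.
  + apply is_derive_Rmult; [exact He|].
    apply is_derive_Rminus; [exact Hd2|apply is_derive_Rscal, Hd1].
  + cbv beta. rewrite !Rpower_exp_mult by exact Hy.
    replace (exp ((mu + (P - 1) * th) * t) * (exp (P * (- th * t)) * Rpower (y t) P))
      with (exp (- th * t) * (exp (mu * t) * Rpower (y t) P)).
    2:{ rewrite <- !Rmult_assoc, <- !exp_plus. do 2 f_equal. ring. }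
    replace (exp (- (nu - (Q - 1) * th) * t) * (exp (Q * (- th * t)) * Rpower (y t) Q))
      with (exp (- th * t) * (exp (- nu * t) * Rpower (y t) Q)).
    2:{ rewrite <- !Rmult_assoc, <- !exp_plus. do 2 f_equal. ring. }
    ring.
Qed.

Lemma is_derive_reflect (f : R -> R) (t l : R) :
  is_derive f (- t) l -> is_derive (fun s => f (- s)) t (- l).
Proof.
intros H. eapply is_derive_val.
- apply (is_derive_Rcomp f (fun s => - s) t l (- 1)); [exact H|].
  apply is_derive_Ropp. exact (is_derive_id t).
- ring.
Qed.

Lemma solves_at_reflect (a b mu nu P Q : R) (y v : R -> R) (t : R) :
  solves_at a b mu nu P Q y v (- t) ->
  solves_at b a nu mu Q P (fun s => y (- s)) (fun s => - v (- s)) t.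
Proof.
intros [Hy [H1 H2]]. split; [exact Hy|split].
- now apply is_derive_reflect.
- eapply is_derive_val.
  + apply is_derive_Ropp, is_derive_reflect, H2.
  + replace (mu * - t) with (- mu * t) by ring. replace (- nu * - t) with (nu * t) by ring. ring.
Qed.

Definition energy (a b mu nu P Q : R) (y v : R -> R) (t : R) : R :=
  v t ^ 2 / 2 - a * b * y t ^ 2 / 2
  + exp (mu * t) * (Rpower (y t) (P + 1) / (P + 1))
  + exp (- nu * t) * (Rpower (y t) (Q + 1) / (Q + 1)).

Lemma is_derive_potential (y : R -> R) (P t dy : R) :
  P + 1 <> 0 -> 0 < y t -> is_derive y t dy ->
  is_derive (fun s => Rpower (y s) (P + 1) / (P + 1)) t (Rpower (y t) P * dy).
Proof.
intros HP Hy Hd. eapply is_derive_val.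
- apply (is_derive_ext (fun s => / (P + 1) * Rpower (y s) (P + 1))).
  { intros s. apply Rmult_comm. }
  apply is_derive_Rscal, (is_derive_Rpower y (P + 1) t dy Hy Hd).
- replace (P + 1 - 1) with P by ring. field. exact HP.
Qed.

Lemma is_derive_half_sqr (f : R -> R) (t a : R) :
  is_derive f t a -> is_derive (fun s => f s ^ 2 / 2) t (f t * a).
Proof.
intros Hf. eapply is_derive_val.
- apply (is_derive_ext (fun s => / 2 * f s ^ 2)); [intros s; apply Rmult_comm|].
  apply is_derive_Rscal, is_derive_Rsqr, Hf.
- field.
Qed.

Lemma is_derive_kinetic (c : R) (y v : R -> R) (t dv : R) :
  is_derive y t (v t) -> is_derive v t dv ->
  is_derive (fun s => v s ^ 2 / 2 - c * y s ^ 2 / 2) t (v t * dv - c * (y t * v t)).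
Proof.
intros H1 H2. apply is_derive_Rminus; [now apply is_derive_half_sqr|].
apply (is_derive_ext (fun s => c * (y s ^ 2 / 2))).
{ intros s. change (@eq R (c * (y s ^ 2 / 2)) (c * y s ^ 2 / 2)). field. }
now apply is_derive_Rscal, is_derive_half_sqr.
Qed.

(** The energy changes through the damping and through the explicit time
dependence of the two potentials; each use below turns on the
signs of these three terms. *)
Lemma is_derive_energy (a b mu nu P Q : R) (y v : R -> R) (t : R) :
  P + 1 <> 0 -> Q + 1 <> 0 -> solves_at a b mu nu P Q y v t ->
  is_derive (energy a b mu nu P Q y v) t
    ((a - b) * v t ^ 2 + mu * (exp (mu * t) * (Rpower (y t) (P + 1) / (P + 1)))
     - nu * (exp (- nu * t) * (Rpower (y t) (Q + 1) / (Q + 1)))).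
Proof.
intros HP HQ [Hy [H1 H2]]. eapply is_derive_val.
- apply is_derive_Rplus; [apply is_derive_Rplus|].
  + exact (is_derive_kinetic (a * b) y v t _ H1 H2).
  + apply is_derive_Rmult; [apply is_derive_exp_lin|apply (is_derive_potential y P t _ HP Hy H1)].
  + apply is_derive_Rmult; [apply is_derive_exp_lin|apply (is_derive_potential y Q t _ HQ Hy H1)].
- cbv beta. ring.
Qed.

(** * Convergence along damped trajectories *)

Lemma exp_decay (nu : R) : 0 < nu -> tends_to (fun t => exp (- nu * t)) 0.
Proof.
intros Hnu eps Heps. exists (Rmax 0 (1 - ln eps / nu)). split; [apply Rmax_l|].
intros t Ht. assert (H := Rmax_r 0 (1 - ln eps / nu)).
rewrite Rminus_0_r, Rabs_pos_eq by apply Rlt_le, exp_pos.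
rewrite <- (exp_ln eps) at 1 by exact Heps. apply exp_increasing.
assert (H1 : nu * t >= nu * (1 - ln eps / nu)) by (apply Rle_ge, Rmult_le_compat_l; lra).
replace (nu * (1 - ln eps / nu)) with (nu - ln eps) in H1 by (field; lra). lra.
Qed.

Lemma exp_neg_le_1 (nu t : R) : 0 < nu -> 0 <= t -> exp (- nu * t) <= 1.
Proof.
intros Hn Ht. rewrite <- exp_0. destruct (Req_dec t 0) as [->|Hne].
- rewrite Rmult_0_r. lra.
- apply Rlt_le, exp_increasing. nra.
Qed.

(** Barbalat's argument: each time |v| >= eps, the bound on v' keeps
|v| >= eps / 2 for a definite time, so S rises by a definite amount, which a
bounded nondecreasing function can do only finitely often. *)
Lemma dissipation_vanishes (S s v chi : R -> R) (T c C D : R) :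
  0 < c -> 0 < D ->
  (forall t, T <= t -> is_derive S t (s t) /\ c * v t ^ 2 <= s t /\ S t <= C /\
                       is_derive v t (chi t) /\ Rabs (chi t) <= D) ->
  tends_to v 0.
Proof.
intros Hc HD H eps Heps.
pose (E := fun z => exists t, T <= t /\ z = S t).
destruct (completeness E) as [L [Hub Hlub]].
- exists C. intros z [t [Ht ->]]. now apply H.
- exists (S T), T. split; [lra|reflexivity].
- assert (Hmono : forall t1 t2, T <= t1 <= t2 -> S t1 <= S t2).
  { intros t1 t2 Ht. apply (nondecreasing_of_derive S s); [lra| |]; intros u Hu;
    destruct (H u) as [Ha [Hb _]]; try lra; [exact Ha|].
    assert (H0 := pow2_ge_0 (v u)). nra. }
  set (h := eps / (2 * D)).
  assert (Hh : 0 < h) by (apply Rdiv_lt_0_compat; lra).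
  set (d := c * (eps / 2) ^ 2 * h).
  assert (Hd : 0 < d).
  { apply Rmult_lt_0_compat; [apply Rmult_lt_0_compat; [lra|apply pow_lt; lra]|exact Hh]. }
  (* After T1 the function S can rise by less than d. *)
  assert (HT1 : exists T1, T <= T1 /\ L - d < S T1).
  { destruct (Classical_Prop.classic (exists T1, T <= T1 /\ L - d < S T1)) as [|Hno]; [assumption|].
    exfalso. assert (L <= L - d); [|lra].
    apply Hlub. intros z [t [Ht ->]]. apply Rnot_lt_le. intros Hlt. apply Hno. now exists t. }
  destruct HT1 as [T1 [HT1 HS1]].
  exists (Rmax 0 T1). split; [apply Rmax_l|].
  intros t Ht. assert (Ht1 : T1 <= t) by (eapply Rle_trans; [apply Rmax_r|exact Ht]).
  rewrite Rminus_0_r. apply Rnot_le_lt. intros Hbig.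
  destruct (mean_value S s t (t + h)) as [x [Hx Ex]]; [lra| |].
  { intros u Hu. apply H. lra. }
  assert (Hvx : eps / 2 <= Rabs (v x)).
  { destruct (mean_value v chi t x) as [x' [Hx' Ex']]; [lra| |].
    { intros u Hu. apply H. lra. }
    destruct (H x') as [_ [_ [_ [_ Hchi]]]]; [lra|].
    assert (Rabs (v x - v t) <= D * h).
    { rewrite Ex', Rabs_mult. apply Rmult_le_compat; try apply Rabs_pos; [exact Hchi|].
      rewrite Rabs_pos_eq; lra. }
    assert (D * h = eps / 2) by (unfold h; field; lra).
    assert (H3 := Rabs_triang_inv (v t) (v x)). rewrite Rabs_minus_sym in H3. lra. }
  destruct (H x) as [_ [Hsx _]]; [lra|].
  assert (H1 : (eps / 2) ^ 2 <= v x ^ 2).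
  { rewrite <- (pow2_abs (v x)). apply pow_incr. lra. }
  assert (H2 : S (t + h) <= L) by (apply Hub; exists (t + h); split; [lra|reflexivity]).
  assert (H3 : S T1 <= S t) by (apply Hmono; lra).
  replace (t + h - t) with h in Ex by ring.
  assert (H4 : c * (eps / 2) ^ 2 <= s x).
  { eapply Rle_trans; [|exact Hsx]. apply Rmult_le_compat_l; lra. }
  assert (H5 : d <= s x * h) by (unfold d; apply Rmult_le_compat_r; lra). lra.
Qed.

(** The energy of the autonomous part, corrected by a multiple of
exp (- nu t), is bounded and monotone with rate at least |a - b| v^2, so v -> 0.
The balance is v' up to vanishing terms, it varies slowly because its derivative
is O(v), and the increment of v over a unit of time vanishes; hence it vanishes
too. *)
Lemma solution_settles (a b nu P Q T C D : R) (y v : R -> R) :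
  a <> b -> 0 < nu -> 1 < P -> 1 < Q -> 0 <= T ->
  (forall t, T <= t -> solves_at a b 0 nu P Q y v t /\ y t <= C /\ Rabs (v t) <= D) ->
  tends_to v 0 /\ tends_to (fun t => a * b * y t - Rpower (y t) P) 0.
Proof.
intros Hab Hnu HP HQ HT H.
assert (HC : 0 < C) by (destruct (H T (Rle_refl _)) as [[Hy _] [Hc _]]; lra).
assert (HD : 0 <= D) by (destruct (H T (Rle_refl _)) as [_ [_ Hd]]; assert (H0 := Rabs_pos (v T)); lra).
set (k := Rabs (a - b)). assert (Hk : 0 < k) by (apply Rabs_pos_lt; lra).
set (A := Rabs (a * b)). assert (HA : 0 <= A) by apply Rabs_pos.
assert (Hpow : forall t r, T <= t -> 0 <= r -> 0 < Rpower (y t) r <= Rpower C r).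
{ intros t r Ht Hr. destruct (H t Ht) as [[Hy _] [Hc _]]. split; [apply Rpower_pos|].
  now apply Rpower_le_base. }
set (chi := fun t => (a - b) * v t + a * b * y t - exp (0 * t) * Rpower (y t) P
                     - exp (- nu * t) * Rpower (y t) Q).
assert (Hexp : forall t, T <= t -> 0 < exp (- nu * t) <= 1).
{ intros t Ht. split; [apply exp_pos|apply exp_neg_le_1; lra]. }
assert (Hy : forall t, T <= t -> 0 < y t <= C).
{ intros t Ht. destruct (H t Ht) as [[Hy _] [Hc _]]. lra. }
assert (Hay : forall t, T <= t -> Rabs (a * b * y t) <= A * C).
{ intros t Ht. rewrite Rabs_mult. fold A. assert (H0 := Hy t Ht).
  rewrite (Rabs_pos_eq (y t)) by lra. apply Rmult_le_compat_l; lra. }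
assert (Hchi : forall t, T <= t -> Rabs (chi t) <= k * D + A * C + Rpower C P + Rpower C Q).
{ intros t Ht. destruct (H t Ht) as [_ [_ Hv]].
  unfold chi. rewrite Rmult_0_l, exp_0, Rmult_1_l.
  assert (B1 : Rabs ((a - b) * v t) <= k * D).
  { rewrite Rabs_mult. fold k. apply Rmult_le_compat_l; lra. }
  assert (B2 := Hay t Ht).
  assert (B3 := Hpow t P Ht ltac:(lra)). assert (B4 := Hpow t Q Ht ltac:(lra)).
  assert (B5 := Hexp t Ht).
  assert (B6 : 0 <= exp (- nu * t) * Rpower (y t) Q <= 1 * Rpower C Q).
  { split; [apply Rmult_le_pos; lra|apply Rmult_le_compat; lra]. }
  apply Rabs_le_between in B1. apply Rabs_le_between in B2. apply Rabs_le. lra. }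
assert (HCP := Rpower_pos C P). assert (HCQ := Rpower_pos C Q).
assert (Hv0 : tends_to v 0).
{ (* The sign of a - b is what makes the damping term of sg * E nonnegative. *)
  assert (Hsg : exists sg, Rabs sg = 1 /\ sg * (a - b) = k).
  { unfold k. destruct (Rle_lt_dec 0 (a - b)).
    - exists 1. rewrite Rabs_R1, Rabs_pos_eq by lra. split; ring.
    - exists (-1). rewrite !Rabs_left by lra. split; ring. }
  destruct Hsg as [sg [Hsg1 Hsg2]].
  set (E := fun t => v t ^ 2 / 2 - a * b * y t ^ 2 / 2 + Rpower (y t) (P + 1) / (P + 1)).
  set (C1 := Rpower C Q * D / nu).
  assert (HC1 : C1 * nu = Rpower C Q * D) by (unfold C1; field; lra).
  set (C2 := D ^ 2 / 2 + A * C ^ 2 / 2 + Rpower C (P + 1) / (P + 1)).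
  apply (dissipation_vanishes (fun t => sg * E t - C1 * exp (- nu * t))
    (fun t => sg * ((a - b) * v t ^ 2 - exp (- nu * t) * Rpower (y t) Q * v t)
              - C1 * (- nu * exp (- nu * t))) v chi T k C2
    (k * D + A * C + Rpower C P + Rpower C Q)); [exact Hk|nra|].
  intros t Ht. destruct (H t Ht) as [[Hyp [Hd1 Hd2]] [_ Hv]].
  assert (B5 := Hexp t Ht). assert (B4 := Hpow t Q Ht ltac:(lra)).
  split; [|split; [|split; [|split]]].
  - apply is_derive_Rminus; [|apply is_derive_Rscal, is_derive_exp_lin].
    apply is_derive_Rscal. eapply is_derive_val.
    + apply is_derive_Rplus; [exact (is_derive_kinetic (a * b) y v t _ Hd1 Hd2)|].
      apply (is_derive_potential y P t (v t)); [lra|exact Hyp|exact Hd1].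
    + rewrite Rmult_0_l, exp_0. ring.
  - replace (C1 * (- nu * exp (- nu * t))) with (- (C1 * nu * exp (- nu * t))) by ring.
    rewrite HC1.
    assert (B : Rabs (sg * (exp (- nu * t) * Rpower (y t) Q * v t)) <= exp (- nu * t) * (Rpower C Q * D)).
    { rewrite Rabs_mult, Hsg1, Rmult_1_l, !Rabs_mult, (Rabs_pos_eq (exp _)), (Rabs_pos_eq (Rpower _ _)) by lra.
      rewrite Rmult_assoc. apply Rmult_le_compat_l; [lra|].
      apply Rmult_le_compat; [lra|apply Rabs_pos|lra|exact Hv]. }
    apply Rabs_le_between in B.
    replace (sg * ((a - b) * v t ^ 2 - exp (- nu * t) * Rpower (y t) Q * v t))
      with (k * v t ^ 2 - sg * (exp (- nu * t) * Rpower (y t) Q * v t)) by (rewrite <- Hsg2; ring).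
    lra.
  - assert (BC1 : 0 <= C1) by (apply Rmult_le_pos; [nra|apply Rlt_le, Rinv_0_lt_compat; lra]).
    assert (BE : Rabs (sg * E t) <= C2).
    { rewrite Rabs_mult, Hsg1, Rmult_1_l. unfold E.
      assert (B1 := Hpow t (P + 1) Ht ltac:(lra)).
      assert (B2 : 0 <= Rpower (y t) (P + 1) / (P + 1) <= Rpower C (P + 1) / (P + 1)).
      { assert (0 < / (P + 1)) by (apply Rinv_0_lt_compat; lra).
        split; [apply Rmult_le_pos; lra|apply Rmult_le_compat_r; lra]. }
      assert (B3 : v t ^ 2 <= D ^ 2) by (rewrite <- (pow2_abs (v t)); apply pow_incr; split; [apply Rabs_pos|exact Hv]).
      assert (B6 := pow2_ge_0 (v t)).
      assert (B7 : Rabs (a * b * y t ^ 2 / 2) <= A * C ^ 2 / 2).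
      { assert (y t ^ 2 <= C ^ 2) by (apply pow_incr; assert (H0 := Hy t Ht); lra).
        assert (0 <= y t ^ 2) by apply pow2_ge_0.
        unfold Rdiv. rewrite !Rabs_mult with (x := _ * _ ^ 2), (Rabs_mult (a * b)), (Rabs_pos_eq (/ 2)), (Rabs_pos_eq (y t ^ 2)) by lra.
        fold A. apply Rmult_le_compat_r; [lra|]. apply Rmult_le_compat_l; lra. }
      apply Rabs_le_between in B7. unfold C2.
      apply Rabs_le. split; [|lra].
      assert (0 <= D ^ 2) by apply pow2_ge_0. lra. }
    apply Rabs_le_between in BE. nra.
  - exact Hd2.
  - apply Hchi, Ht. }
split; [exact Hv0|].
set (h := fun t => a * b * y t - Rpower (y t) P).
set (dh := fun t => a * b * v t - P * Rpower (y t) (P - 1) * v t).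
assert (Hdh : forall t, T <= t -> is_derive h t (dh t)).
{ intros t Ht. destruct (H t Ht) as [[Hyp [Hd1 _]] _].
  apply is_derive_Rminus; [now apply is_derive_Rscal|now apply is_derive_Rpower]. }
set (K := A + P * Rpower C (P - 1)).
assert (HK : 0 <= K) by (assert (H0 := Rpower_pos C (P - 1)); unfold K; nra).
assert (Hbdh : forall t, T <= t -> Rabs (dh t) <= K * Rabs (v t)).
{ intros t Ht. unfold dh.
  replace (a * b * v t - P * Rpower (y t) (P - 1) * v t) with ((a * b - P * Rpower (y t) (P - 1)) * v t) by ring.
  rewrite Rabs_mult. apply Rmult_le_compat_r; [apply Rabs_pos|].
  assert (B := Hpow t (P - 1) Ht ltac:(lra)).
  eapply Rle_trans; [apply Rabs_triang|]. rewrite Rabs_Ropp, (Rabs_mult P), (Rabs_pos_eq P), (Rabs_pos_eq (Rpower _ _)) by lra.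
  unfold K. fold A. apply Rplus_le_compat_l, Rmult_le_compat_l; lra. }
intros eps Heps. rename H into Hsol.
destruct (Hv0 (eps / (2 * (2 + k + K)))) as [T1 [HT1 HvT]]; [apply Rdiv_lt_0_compat; lra|].
destruct (exp_decay nu Hnu (eps / (2 * (Rpower C Q)))) as [T2 [HT2 HeT]]; [apply Rdiv_lt_0_compat; lra|].
exists (T + T1 + T2). split; [lra|]. intros t Ht. rewrite Rminus_0_r. fold (h t).
destruct (mean_value v chi t (t + 1)) as [c [Hc Ec]]; [lra| |].
{ intros s Hs. apply Hsol. lra. }
destruct (mean_value h dh t c) as [c' [Hc' Ec']]; [lra| |].
{ intros s Hs. apply Hdh. lra. }
set (e1 := eps / (2 * (2 + k + K))) in *.
assert (He1 : (2 + k + K) * e1 = eps / 2) by (unfold e1; field; lra).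
assert (V1 := HvT (t + 1) ltac:(lra)). assert (V2 := HvT t ltac:(lra)).
assert (V3 := HvT c ltac:(lra)). assert (V4 := HvT c' ltac:(lra)).
rewrite Rminus_0_r in V1, V2, V3, V4.
assert (V5 := HeT c ltac:(lra)). rewrite Rminus_0_r, Rabs_pos_eq in V5 by apply Rlt_le, exp_pos.
replace (h t) with (v (t + 1) - v t - (a - b) * v c + exp (- nu * c) * Rpower (y c) Q
                    - dh c' * (c - t)).
2:{ rewrite <- Ec'. replace (v (t + 1) - v t) with (chi c) by (rewrite Ec; ring).
    unfold chi, h. rewrite Rmult_0_l, exp_0. ring. }
assert (B1 : Rabs ((a - b) * v c) <= k * e1).
{ rewrite Rabs_mult. fold k. apply Rmult_le_compat_l; lra. }
assert (B2 : Rabs (dh c' * (c - t)) <= K * e1).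
{ rewrite Rabs_mult, <- (Rmult_1_r (K * e1)). apply Rmult_le_compat; try apply Rabs_pos.
  - eapply Rle_trans; [apply Hbdh; lra|]. apply Rmult_le_compat_l; lra.
  - rewrite Rabs_pos_eq; lra. }
assert (B3 : 0 <= exp (- nu * c) * Rpower (y c) Q < eps / 2).
{ assert (B4 := Hpow c Q ltac:(lra) ltac:(lra)).
  assert (B5 := exp_pos (- nu * c)).
  split; [apply Rmult_le_pos; lra|].
  apply Rle_lt_trans with (exp (- nu * c) * Rpower C Q); [apply Rmult_le_compat_l; lra|].
  apply Rmult_lt_compat_r with (r := Rpower C Q) in V5; [|lra].
  replace (eps / (2 * Rpower C Q) * Rpower C Q) with (eps / 2) in V5 by (field; lra). exact V5. }
apply Rabs_le_between in B1. apply Rabs_le_between in B2.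
apply Rabs_def2 in V1. apply Rabs_def2 in V2.
apply Rabs_def1; lra.
Qed.

(** * Truncation of the power nonlinearities *)

(** Cut off above M to be globally Lipschitz, and extended by 0 to the left because
[Rpower] takes the value 1 at 0. *)
Definition truncated_power (M P x : R) : R :=
  if Rle_dec x 0 then 0 else Rpower (Rmin x M) P.

Lemma truncated_power_eq (M P x : R) : 0 < x <= M -> truncated_power M P x = Rpower x P.
Proof.
intros Hx. unfold truncated_power. destruct (Rle_dec x 0) as [H|H]; [lra|].
now rewrite Rmin_left by lra.
Qed.

Lemma truncated_power_lipschitz (M P x y : R) :
  0 < M -> 1 < P ->
  Rabs (truncated_power M P x - truncated_power M P y) <= P * Rpower M (P - 1) * Rabs (x - y).
Proof.
intros HM HP.
assert (HK := Rpower_pos M (P - 1)).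
assert (mixed : forall x y, x <= 0 -> 0 < y ->
  Rabs (Rpower (Rmin y M) P) <= P * Rpower M (P - 1) * Rabs (x - y)).
{ intros u z Hu Hz. assert (Hmin : 0 < Rmin z M) by (apply Rmin_glb_lt; lra).
  rewrite Rabs_pos_eq by apply Rlt_le, Rpower_pos.
  rewrite (Rpower_mult_base _ P Hmin), (Rabs_left (u - z)) by lra.
  assert (H1 := Rpower_le_base _ _ (P - 1) ltac:(lra) Hmin (Rmin_r z M)).
  assert (H2 := Rmin_l z M). assert (H3 := Rpower_pos (Rmin z M) (P - 1)).
  apply Rle_trans with (z * Rpower M (P - 1)); [apply Rmult_le_compat; lra|].
  assert (z * Rpower M (P - 1) <= - (u - z) * Rpower M (P - 1)) by (apply Rmult_le_compat_r; lra).
  assert (0 <= - (u - z) * Rpower M (P - 1)) by (apply Rmult_le_pos; lra). nra. }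
unfold truncated_power. destruct (Rle_dec x 0) as [Hx|Hx]; destruct (Rle_dec y 0) as [Hy|Hy].
- rewrite Rminus_diag, Rabs_R0. assert (H := Rabs_pos (x - y)). apply Rmult_le_pos; nra.
- rewrite Rminus_0_l, Rabs_Ropp. apply mixed; lra.
- rewrite Rminus_0_r, (Rabs_minus_sym x y). apply mixed; lra.
- assert (H1 : 0 < Rmin x M) by (apply Rmin_glb_lt; lra).
  assert (H2 : 0 < Rmin y M) by (apply Rmin_glb_lt; lra).
  eapply Rle_trans.
  + apply (Rpower_lipschitz _ _ M P HP (conj H1 (Rmin_r _ _)) (conj H2 (Rmin_r _ _))).
  + apply Rmult_le_compat_l; [nra|].
    unfold Rmin. destruct (Rle_dec x M); destruct (Rle_dec y M);
      unfold Rabs; repeat destruct Rcase_abs; lra.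
Qed.

Definition truncated_field (a b mu nu P Q M t x v : R) : R :=
  (a - b) * v + a * b * x - exp (mu * t) * truncated_power M P x
  - exp (- nu * t) * truncated_power M Q x.

Definition truncated_solution (a b mu nu P Q M : R) (x v : R -> R) : Prop :=
  forall t, is_derive x t (v t) /\ is_derive v t (truncated_field a b mu nu P Q M t (x t) (v t)).

Lemma exp_le_exp (x y : R) : x <= y -> exp x <= exp y.
Proof.
intros [H| ->]; [now apply Rlt_le, exp_increasing|apply Rle_refl].
Qed.

Lemma truncated_field_lipschitz (a b mu nu P Q M t0 rho : R) :
  0 < M -> 1 < P -> 1 < Q ->
  exists L, 0 <= L /\ forall t x v x' v', Rabs (t - t0) <= rho ->
    Rabs (truncated_field a b mu nu P Q M t x v - truncated_field a b mu nu P Q M t x' v')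
    <= L * (Rabs (x - x') + Rabs (v - v')).
Proof.
intros HM HP HQ.
assert (Hexp : forall c t, Rabs (t - t0) <= rho -> exp (c * t) <= exp (Rabs c * (Rabs t0 + rho))).
{ intros c t Ht. apply exp_le_exp. eapply Rle_trans; [apply Rle_abs|]. rewrite Rabs_mult.
  apply Rmult_le_compat_l; [apply Rabs_pos|].
  replace t with (t0 + (t - t0)) by ring. eapply Rle_trans; [apply Rabs_triang|]. lra. }
set (E1 := exp (Rabs mu * (Rabs t0 + rho)) * (P * Rpower M (P - 1))).
set (E2 := exp (Rabs (- nu) * (Rabs t0 + rho)) * (Q * Rpower M (Q - 1))).
assert (L1 := Rpower_pos M (P - 1)). assert (L2 := Rpower_pos M (Q - 1)).
assert (HE1 : 0 <= E1) by (apply Rmult_le_pos; [apply Rlt_le, exp_pos|nra]).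
assert (HE2 : 0 <= E2) by (apply Rmult_le_pos; [apply Rlt_le, exp_pos|nra]).
assert (L4 := Rabs_pos (a - b)). assert (L5 := Rabs_pos (a * b)).
exists (Rabs (a - b) + Rabs (a * b) + E1 + E2). split; [lra|].
intros t x v x' v' Ht.
assert (Hterm : forall c R0, 1 < R0 -> Rabs (exp (c * t) * (truncated_power M R0 x - truncated_power M R0 x'))
   <= exp (Rabs c * (Rabs t0 + rho)) * (R0 * Rpower M (R0 - 1)) * Rabs (x - x')).
{ intros c R0 HR0. rewrite Rabs_mult, (Rabs_pos_eq (exp _)), Rmult_assoc by apply Rlt_le, exp_pos.
  apply Rmult_le_compat; [apply Rlt_le, exp_pos|apply Rabs_pos|now apply Hexp|].
  now apply truncated_power_lipschitz. }
assert (B1 := Hterm mu P HP). assert (B2 := Hterm (- nu) Q HQ). fold E1 in B1. fold E2 in B2.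
unfold truncated_field.
match goal with |- Rabs ?u <= _ => replace u with
  ((a - b) * (v - v') + a * b * (x - x') - exp (mu * t) * (truncated_power M P x - truncated_power M P x')
   - exp (- nu * t) * (truncated_power M Q x - truncated_power M Q x')) by ring end.
assert (Px := Rabs_pos (x - x')). assert (Pv := Rabs_pos (v - v')).
eapply Rle_trans; [apply Rabs_triang|]. rewrite Rabs_Ropp.
eapply Rle_trans; [apply Rplus_le_compat_r, Rabs_triang|]. rewrite Rabs_Ropp.
eapply Rle_trans; [apply Rplus_le_compat_r, Rplus_le_compat_r, Rabs_triang|].
rewrite (Rabs_mult (a - b)), (Rabs_mult (a * b)).
assert (0 <= Rabs (a * b) * Rabs (v - v')) by (apply Rmult_le_pos; lra).
assert (0 <= Rabs (a - b) * Rabs (x - x')) by (apply Rmult_le_pos; lra).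
assert (0 <= E1 * Rabs (v - v')) by (apply Rmult_le_pos; lra).
assert (0 <= E2 * Rabs (v - v')) by (apply Rmult_le_pos; lra). lra.
Qed.

Lemma continuous_truncated_power (M P : R) (x : R -> R) (t : R) :
  0 < M -> 1 < P -> continuous x t -> continuous (fun s => truncated_power M P (x s)) t.
Proof.
intros HM HP Hx. apply continuous_eps. intros eps Heps.
set (K := P * Rpower M (P - 1)).
assert (HK : 0 < K) by (apply Rmult_lt_0_compat; [lra|apply Rpower_pos]).
destruct (proj1 (continuous_eps x t) Hx (eps / K)) as [d [Hd0 Hd]]; [now apply Rdiv_lt_0_compat|].
exists d. split; [exact Hd0|]. intros s Hs.
eapply Rle_lt_trans; [now apply truncated_power_lipschitz|]. fold K.
replace eps with (K * (eps / K)) by (field; lra).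
apply Rmult_lt_compat_l; [exact HK|now apply Hd].
Qed.

Lemma truncated_solution_exists (a b mu nu P Q M t0 x0 v0 : R) :
  0 < M -> 1 < P -> 1 < Q ->
  exists x v, x t0 = x0 /\ v t0 = v0 /\ truncated_solution a b mu nu P Q M x v.
Proof.
intros HM HP HQ. apply global_solution.
- intros x v Hx Hv t. unfold truncated_field.
  assert (Hexp : forall c, continuous (fun s => exp (c * s)) t)
    by (intros c; apply (is_derive_continuous _ _ _ (is_derive_exp_lin c t))).
  apply continuous_Rminus; [apply continuous_Rminus; [apply continuous_Rplus|]|];
    apply continuous_Rmult; try apply continuous_const; try apply Hexp; auto;
    now apply continuous_truncated_power.
- intros rho. now apply truncated_field_lipschitz.
Qed.

(** The constant K depends on the two times only, not on the solutions: this is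
what transports a cluster point of initial data to a cluster point at any other
time. *)
Lemma truncated_dependence (a b mu nu P Q M t0 t : R) :
  0 < M -> 1 < P -> 1 < Q ->
  exists K, 0 < K /\ forall x1 v1 x2 v2,
    truncated_solution a b mu nu P Q M x1 v1 -> truncated_solution a b mu nu P Q M x2 v2 ->
    (x1 t - x2 t) ^ 2 + (v1 t - v2 t) ^ 2 <= ((x1 t0 - x2 t0) ^ 2 + (v1 t0 - v2 t0) ^ 2) * K.
Proof.
intros HM HP HQ.
destruct (truncated_field_lipschitz a b mu nu P Q M t0 (Rabs (t - t0)) HM HP HQ) as [L [HL HF]].
assert (main : forall x1 v1 x2 v2 t1 t2,
    truncated_solution a b mu nu P Q M x1 v1 -> truncated_solution a b mu nu P Q M x2 v2 -> t1 <= t2 ->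
    (forall s, t1 <= s <= t2 -> Rabs (s - t0) <= Rabs (t - t0)) ->
  let N s := (x1 s - x2 s) ^ 2 + (v1 s - v2 s) ^ 2 in
  N t2 <= N t1 * exp ((1 + 3 * L) * (t2 - t1)) /\ N t1 <= N t2 * exp ((1 + 3 * L) * (t2 - t1))).
{ intros x1 v1 x2 v2 t1 t2 H1 H2 Ht Hs N.
  apply (gronwall (fun s => x1 s - x2 s) (fun s => v1 s - v2 s)
   (fun s => truncated_field a b mu nu P Q M s (x1 s) (v1 s) - truncated_field a b mu nu P Q M s (x2 s) (v2 s))
   L t1 t2 HL Ht).
  intros s Hs'. destruct (H1 s) as [A1 A2]. destruct (H2 s) as [B1 B2].
  split; [now apply is_derive_Rminus|split; [now apply is_derive_Rminus|]].
  now apply HF, Hs. }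
exists (exp ((1 + 3 * L) * Rabs (t - t0))). split; [apply exp_pos|].
intros x1 v1 x2 v2 H1 H2.
destruct (Rle_lt_dec t0 t) as [Hle|Hlt].
- rewrite Rabs_pos_eq by lra. apply (main x1 v1 x2 v2 t0 t H1 H2 Hle).
  intros s Hs. rewrite !Rabs_pos_eq; lra.
- rewrite Rabs_left by lra. replace (- (t - t0)) with (t0 - t) by ring.
  apply (main x1 v1 x2 v2 t t0 H1 H2); [lra|].
  intros s Hs. rewrite !Rabs_left1; lra.
Qed.

Lemma truncated_solution_unique (a b mu nu P Q M t0 : R) (x1 v1 x2 v2 : R -> R) :
  0 < M -> 1 < P -> 1 < Q ->
  truncated_solution a b mu nu P Q M x1 v1 -> truncated_solution a b mu nu P Q M x2 v2 ->
  x1 t0 = x2 t0 -> v1 t0 = v2 t0 -> forall t, x1 t = x2 t.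
Proof.
intros HM HP HQ H1 H2 Ex Ev t.
destruct (truncated_dependence a b mu nu P Q M t0 t HM HP HQ) as [K [_ HK]].
specialize (HK x1 v1 x2 v2 H1 H2). rewrite Ex, Ev, !Rminus_diag in HK.
assert (Q1 := pow2_ge_0 (x1 t - x2 t)). assert (Q2 := pow2_ge_0 (v1 t - v2 t)).
apply Rminus_diag_uniq, Rsqr_0_uniq. rewrite Rsqr_pow2. lra.
Qed.

Lemma truncated_solution_of_solves (a b mu nu P Q M : R) (y v : R -> R) :
  solves a b mu nu P Q y v -> (forall t, y t <= M) -> truncated_solution a b mu nu P Q M y v.
Proof.
intros H HM t. destruct (H t) as [Hy [H1 H2]]. split; [exact H1|].
unfold truncated_field. rewrite !truncated_power_eq by (split; auto). exact H2.
Qed.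

Lemma solves_at_of_truncated (a b mu nu P Q M : R) (x v : R -> R) (t : R) :
  truncated_solution a b mu nu P Q M x v -> 0 < x t <= M -> solves_at a b mu nu P Q x v t.
Proof.
intros H Hx. destruct (H t) as [H1 H2]. split; [lra|split; [exact H1|]].
unfold truncated_field in H2. rewrite !truncated_power_eq in H2 by exact Hx. exact H2.
Qed.

(** * A priori bounds and uniqueness of persistent solutions *)

Lemma balance_limit (y : R -> R) (A P m T : R) :
  0 < A -> 1 < P -> 0 < m -> (forall t, T <= t -> m <= y t) ->
  tends_to (fun t => A * y t - Rpower (y t) P) 0 ->
  tends_to y (Rpower A (/ (P - 1))).
Proof.
intros HA HP Hm Hy Hh eps0 Heps0.
set (lam := Rpower A (/ (P - 1))).
assert (Hlam : 0 < lam) by apply Rpower_pos.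
assert (HlamA : Rpower lam (P - 1) = A) by (apply Rpower_inv_base; lra).
set (eps := Rmin eps0 (lam / 2)).
assert (Heps : 0 < eps) by (apply Rmin_glb_lt; lra).
assert (Heps1 : eps <= eps0) by apply Rmin_l.
assert (Heps2 : eps <= lam / 2) by apply Rmin_r.
assert (H1 := Rpower_lt_base lam (lam + eps) (P - 1) ltac:(lra) Hlam ltac:(lra)).
assert (H2 := Rpower_lt_base (lam - eps) lam (P - 1) ltac:(lra) ltac:(lra) ltac:(lra)).
rewrite HlamA in H1, H2.
set (d := Rmin (Rpower (lam + eps) (P - 1) - A) (A - Rpower (lam - eps) (P - 1))).
assert (Hd : 0 < d) by (apply Rmin_glb_lt; lra).
assert (Hd1 : d <= Rpower (lam + eps) (P - 1) - A) by apply Rmin_l.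
assert (Hd2 : d <= A - Rpower (lam - eps) (P - 1)) by apply Rmin_r.
destruct (Hh (m * d)) as [T1 [HT1 Hsmall]]; [nra|].
exists (Rmax T1 T). split; [eapply Rle_trans; [exact HT1|apply Rmax_l]|].
intros t Ht.
assert (Ht1 : T1 <= t) by (eapply Rle_trans; [apply Rmax_l|exact Ht]).
assert (Ht2 : T <= t) by (eapply Rle_trans; [apply Rmax_r|exact Ht]).
assert (Hyt := Hy t Ht2). specialize (Hsmall t Ht1).
rewrite Rminus_0_r, (Rpower_mult_base (y t) P) in Hsmall by lra.
apply Rabs_def2 in Hsmall.
apply Rlt_le_trans with eps; [|exact Heps1].
apply Rabs_def1; apply Rnot_le_lt; intros Hbad.
- assert (H3 := Rpower_le_base (lam + eps) (y t) (P - 1) ltac:(lra) ltac:(lra) ltac:(lra)). nra.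
- assert (H3 := Rpower_le_base (y t) (lam - eps) (P - 1) ltac:(lra) ltac:(lra) ltac:(lra)). nra.
Qed.

(** Below the positive root of A y = y^P the balance is positive at a fixed level
m, so y cannot take the value m at late times; being above m once, y stays above
it by continuity. *)
Lemma balance_persistence (y : R -> R) (A P c : R) :
  0 < A -> 1 < P -> 0 < c -> (forall t, continuous y t) ->
  (forall T, exists t, T <= t /\ c <= y t) ->
  tends_to (fun t => A * y t - Rpower (y t) P) 0 ->
  exists m T, 0 < m /\ 0 <= T /\ forall t, T <= t -> m <= y t.
Proof.
intros HA HP Hc Hcont Hfreq Hh.
set (lam := Rpower A (/ (P - 1))).
assert (Hlam : 0 < lam) by apply Rpower_pos.
assert (HlamA : Rpower lam (P - 1) = A) by (apply Rpower_inv_base; lra).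
set (m := Rmin c (lam / 2)).
assert (Hm : 0 < m) by (apply Rmin_glb_lt; lra).
assert (Hmc : m <= c) by apply Rmin_l. assert (Hml : m <= lam / 2) by apply Rmin_r.
assert (H2 := Rpower_lt_base m lam (P - 1) ltac:(lra) ltac:(lra) ltac:(lra)).
rewrite HlamA in H2.
destruct (Hh (m * (A - Rpower m (P - 1)))) as [T1 [HT1 Hsmall]]; [nra|].
assert (Hne : forall t, T1 <= t -> y t <> m).
{ intros t Ht He. specialize (Hsmall t Ht).
  rewrite He, Rminus_0_r, (Rpower_mult_base m P) in Hsmall by lra.
  apply Rabs_def2 in Hsmall. lra. }
destruct (Hfreq T1) as [t1 [Ht1 Hyt1]].
exists m, t1. split; [exact Hm|split; [lra|]].
intros t Ht. apply Rnot_lt_le. intros Hlt.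
destruct (IVT_gen y t1 t m) as [s [Hs1 Hs2]].
- intros s. apply continuity_pt_filterlim, Hcont.
- rewrite Rmin_right, Rmax_left by lra. lra.
- rewrite Rmin_left, Rmax_right in Hs1 by lra. apply (Hne s); [lra|exact Hs2].
Qed.

(** With X = exp (b t) (y' - a y) the equation says X' < 0.  If X were positive
at some time it would be bounded below by a positive constant at all earlier
times, which would drive exp (- a t) y to minus infinity as t -> -oo. *)
Lemma slope_upper (a b mu nu P Q : R) (y v : R -> R) :
  0 < a + b -> solves a b mu nu P Q y v -> forall t, v t <= a * y t.
Proof.
intros Hab Hsol t0. apply Rnot_lt_le. intros Hbad.
set (X := fun t => exp (b * t) * (v t - a * y t)).
set (F := fun t => exp (mu * t) * Rpower (y t) P + exp (- nu * t) * Rpower (y t) Q).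
assert (HF : forall t, 0 < F t).
{ intros t. apply Rplus_lt_0_compat; apply Rmult_lt_0_compat; (apply exp_pos || apply Rpower_pos). }
assert (HX : forall t, is_derive X t (- (exp (b * t) * F t))).
{ intros t. destruct (Hsol t) as [Hy [H1 H2]]. eapply is_derive_val.
  - apply is_derive_Rmult; [apply is_derive_exp_lin|].
    apply is_derive_Rminus; [exact H2|apply is_derive_Rscal, H1].
  - unfold F. cbv beta. ring. }
assert (HXmono : forall t, t <= t0 -> X t0 <= X t).
{ intros t Ht. apply Ropp_le_cancel.
  apply (nondecreasing_of_derive (fun t => - X t) (fun t => - - (exp (b * t) * F t)) t t0 Ht).
  - intros s _. apply is_derive_Ropp, HX.
  - intros s _. rewrite Ropp_involutive. apply Rlt_le, Rmult_lt_0_compat; [apply exp_pos|apply HF]. }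
set (c := X t0). assert (Hc : 0 < c) by (apply Rmult_lt_0_compat; [apply exp_pos|lra]).
(* (exp (- a t) y)' = exp (- (a + b) t) X >= c exp (- (a + b) t) for t <= t0. *)
set (phi := fun t => exp (- a * t) * y t + c / (a + b) * exp (- (a + b) * t)).
assert (Hphi : forall t, t <= t0 -> phi t <= phi t0).
{ intros t Ht.
  apply (nondecreasing_of_derive phi (fun t => exp (- (a + b) * t) * (X t - c)) t t0 Ht).
  - intros s _. destruct (Hsol s) as [Hy [H1 _]]. eapply is_derive_val.
    + apply is_derive_Rplus.
      * apply is_derive_Rmult; [apply is_derive_exp_lin|exact H1].
      * apply is_derive_Rscal, is_derive_exp_lin.
    + unfold X. cbv beta. replace (exp (- a * s)) with (exp (- (a + b) * s) * exp (b * s)).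
      * field. lra.
      * rewrite <- exp_plus. f_equal. ring.
  - intros s Hs. apply Rmult_le_pos; [apply Rlt_le, exp_pos|].
    assert (H := HXmono s ltac:(lra)). fold c in H. lra. }
set (K := phi t0).
(* Early enough for the exponential term of phi alone to exceed K. *)
set (t := - (Rabs K / c) - Rabs t0).
assert (HKc : 0 <= Rabs K / c).
{ apply Rmult_le_pos; [apply Rabs_pos|apply Rlt_le, Rinv_0_lt_compat, Hc]. }
assert (Ht : t <= t0).
{ unfold t. assert (H := Rle_abs (- t0)). rewrite Rabs_Ropp in H. lra. }
assert (H1 := Hphi t Ht). fold K in H1. unfold phi in H1.
assert (H2 : 0 < exp (- a * t) * y t) by (apply Rmult_lt_0_compat; [apply exp_pos|apply Hsol]).
assert (H3 := exp_ineq1_le (- (a + b) * t)).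
assert (H4 : 0 < c / (a + b)) by (apply Rdiv_lt_0_compat; lra).
assert (H5 : c / (a + b) * (1 + - (a + b) * t) <= K).
{ apply Rmult_le_compat_l with (r := c / (a + b)) in H3; lra. }
replace (c / (a + b) * (1 + - (a + b) * t)) with (c / (a + b) - c * t) in H5 by (field; lra).
assert (H6 : - (c * t) = Rabs K + c * Rabs t0) by (unfold t; field; lra).
assert (H7 := Rle_abs K). assert (H8 := Rabs_pos t0). nra.
Qed.

(** The upper bound for the reflected solution. *)
Lemma slope_lower (a b mu nu P Q : R) (y v : R -> R) :
  0 < a + b -> solves a b mu nu P Q y v -> forall t, - b * y t <= v t.
Proof.
intros Hab Hsol t.
assert (H := slope_upper b a nu mu Q P (fun s => y (- s)) (fun s => - v (- s))
   ltac:(lra) (fun s => solves_at_reflect a b mu nu P Q y v s (Hsol (- s))) (- t)).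
cbv beta in H. rewrite Ropp_involutive in H. lra.
Qed.

(** Over a unit of time y changes at most by fixed factors, so X = exp (b t) (y' - a y)
drops by at least a multiple of y^P, while the slope bounds only allow a drop
proportional to y. *)
Lemma solution_bound (a b nu P Q : R) (y v : R -> R) :
  0 < a -> 0 < b -> 1 < P -> solves a b 0 nu P Q y v ->
  forall t, y t <= Rpower ((a + b) * exp (a + b + b * P)) (/ (P - 1)).
Proof.
intros Ha Hb HP Hsol t1.
assert (Hup := slope_upper a b 0 nu P Q y v ltac:(lra) Hsol).
assert (Hlo := slope_lower a b 0 nu P Q y v ltac:(lra) Hsol).
assert (Hy : forall t, 0 < y t) by (intros t; apply Hsol).
assert (Hyd : forall t, is_derive y t (v t)) by (intros t; apply Hsol).
set (X := fun t => exp (b * t) * (v t - a * y t)).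
set (F := fun t => exp (0 * t) * Rpower (y t) P + exp (- nu * t) * Rpower (y t) Q).
assert (HX : forall t, is_derive X t (- (exp (b * t) * F t))).
{ intros t. destruct (Hsol t) as [_ [H1 H2]]. eapply is_derive_val.
  - apply is_derive_Rmult; [apply is_derive_exp_lin|].
    apply is_derive_Rminus; [exact H2|apply is_derive_Rscal, H1].
  - unfold F. cbv beta. ring. }
assert (Hdec : forall s, t1 <= s -> exp (- b * (s - t1)) * y t1 <= y s).
{ intros s Hs.
  assert (H : exp (b * t1) * y t1 <= exp (b * s) * y s).
  { apply (nondecreasing_of_derive (fun s => exp (b * s) * y s)
      (fun s => exp (b * s) * (v s + b * y s)) t1 s Hs).
    - intros u _. eapply is_derive_val.
      + apply is_derive_Rmult; [apply is_derive_exp_lin|apply Hyd].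
      + cbv beta. ring.
    - intros u _. apply Rmult_le_pos; [apply Rlt_le, exp_pos|]. assert (H := Hlo u). lra. }
  apply Rmult_le_reg_l with (exp (b * s)); [apply exp_pos|].
  rewrite <- Rmult_assoc, <- exp_plus.
  replace (b * s + - b * (s - t1)) with (b * t1) by ring. exact H. }
assert (Hinc : y (t1 + 1) <= exp a * y t1).
{ assert (H : - (exp (- a * t1) * y t1) <= - (exp (- a * (t1 + 1)) * y (t1 + 1))).
  { apply (nondecreasing_of_derive (fun s => - (exp (- a * s) * y s))
      (fun s => exp (- a * s) * (a * y s - v s)) t1 (t1 + 1)); [lra| |].
    - intros u _. eapply is_derive_val.
      + apply is_derive_Ropp, is_derive_Rmult; [apply is_derive_exp_lin|apply Hyd].
      + cbv beta. ring.
    - intros u _. apply Rmult_le_pos; [apply Rlt_le, exp_pos|]. assert (H := Hup u). lra. }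
  apply Rmult_le_reg_l with (exp (- a * (t1 + 1))); [apply exp_pos|].
  rewrite <- Rmult_assoc, <- exp_plus.
  replace (- a * (t1 + 1) + a) with (- a * t1) by ring. lra. }
destruct (mean_value X (fun t => - (exp (b * t) * F t)) t1 (t1 + 1)) as [c [Hc Ec]]; [lra| |].
{ intros s _. apply HX. }
set (w := y t1) in *. assert (Hw : 0 < w) by apply Hy.
assert (HXt1 : X t1 <= 0).
{ unfold X. assert (H := Hup t1). assert (H1 := exp_pos (b * t1)). fold w in H |- *. nra. }
assert (HX1 : - (exp (b * t1) * (exp (a + b) * (a + b) * w)) <= X (t1 + 1)).
{ unfold X. replace (b * (t1 + 1)) with (b * t1 + b) by ring. rewrite !exp_plus, !Rmult_assoc.
  rewrite Ropp_mult_distr_r. apply Rmult_le_compat_l; [apply Rlt_le, exp_pos|].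
  replace (- (exp a * (exp b * ((a + b) * w)))) with (exp b * (- ((a + b) * (exp a * w)))) by ring.
  apply Rmult_le_compat_l; [apply Rlt_le, exp_pos|].
  assert (H := Hlo (t1 + 1)). nra. }
assert (HFc : exp (b * t1) * (exp (- b * P) * Rpower w P) <= exp (b * c) * F c).
{ assert (H1 : exp (b * t1) <= exp (b * c)).
  { destruct (Req_dec c t1) as [->|Hne]; [lra|]. apply Rlt_le, exp_increasing. nra. }
  apply Rmult_le_compat; [apply Rlt_le, exp_pos| |exact H1|].
  - apply Rlt_le, Rmult_lt_0_compat; [apply exp_pos|apply Rpower_pos].
  - unfold F. rewrite Rmult_0_l, exp_0, Rmult_1_l.
    assert (H2 : 0 < exp (- nu * c) * Rpower (y c) Q) by (apply Rmult_lt_0_compat; [apply exp_pos|apply Rpower_pos]).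
    enough (exp (- b * P) * Rpower w P <= Rpower (y c) P) by lra.
    replace (- b * P) with (P * (- b)) by ring.
    rewrite <- Rpower_exp_mult by exact Hw.
    apply Rpower_le_base; [lra|apply Rmult_lt_0_compat; [apply exp_pos|exact Hw]|].
    eapply Rle_trans; [|apply Hdec; lra].
    apply Rmult_le_compat_r; [lra|].
    destruct (Req_dec c (t1 + 1)) as [->|Hne].
    + replace (- b * (t1 + 1 - t1)) with (- b) by ring. lra.
    + apply Rlt_le, exp_increasing. nra. }
replace (t1 + 1 - t1) with 1 in Ec by ring. rewrite Rmult_1_r in Ec.
assert (H : exp (b * t1) * (exp (- b * P) * Rpower w P) <= exp (b * t1) * (exp (a + b) * (a + b) * w)) by lra.
apply Rmult_le_reg_l in H; [|apply exp_pos].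
rewrite (Rpower_mult_base w P Hw) in H.
assert (H1 : exp (- b * P) * Rpower w (P - 1) <= exp (a + b) * (a + b)).
{ apply Rmult_le_reg_r with w; [exact Hw|]. lra. }
assert (H2 : Rpower w (P - 1) <= (a + b) * exp (a + b + b * P)).
{ apply Rmult_le_reg_l with (exp (- b * P)); [apply exp_pos|].
  replace (exp (- b * P) * ((a + b) * exp (a + b + b * P))) with (exp (a + b) * (a + b)); [exact H1|].
  replace (a + b) with ((- b * P) + (a + b + b * P)) at 1 by ring. rewrite exp_plus. ring. }
replace w with (Rpower (Rpower w (P - 1)) (/ (P - 1))).
- apply Rpower_le_base; [apply Rlt_le, Rinv_0_lt_compat; lra|apply Rpower_pos|exact H2].
- rewrite Rpower_mult, Rinv_r by lra. now apply Rpower_1.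
Qed.

Lemma tends_to_minus (f g : R -> R) : tends_to f 0 -> tends_to g 0 -> tends_to (fun t => f t - g t) 0.
Proof.
intros Hf Hg eps He. destruct (Hf (eps / 2)) as [T1 [P1 H1]]; [lra|].
destruct (Hg (eps / 2)) as [T2 [P2 H2]]; [lra|].
exists (T1 + T2). split; [lra|]. intros t Ht.
specialize (H1 t ltac:(lra)). specialize (H2 t ltac:(lra)).
rewrite Rminus_0_r in *. eapply Rle_lt_trans; [apply Rabs_triang|].
rewrite Rabs_Ropp. lra.
Qed.

(** Near the equilibrium the difference phi obeys
phi'' = k phi' - c0 phi + rho with k > 0, c0 > 0 and rho = o(phi).  The function
psi^2 / 2 + c0 phi^2 / 2 - g phi psi, with psi = phi' and a small weight g, is
positive definite and nondecreasing at late times; the cross term is what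
produces growth in the phi direction, where k psi^2 alone gives none.  Since it
tends to 0, it is 0. *)
Lemma eventual_uniqueness (a b nu P Q : R) (y1 v1 y2 v2 : R -> R) :
  0 < b -> b < a -> 0 < nu -> 1 < P -> 1 < Q ->
  solves a b 0 nu P Q y1 v1 -> solves a b 0 nu P Q y2 v2 ->
  tends_to y1 (Rpower (a * b) (/ (P - 1))) -> tends_to y2 (Rpower (a * b) (/ (P - 1))) ->
  tends_to v1 0 -> tends_to v2 0 ->
  exists T, forall t, T <= t -> y1 t = y2 t /\ v1 t = v2 t.
Proof.
intros Hb Hab Hnu HP HQ Hs1 Hs2 Hy1 Hy2 Hv1 Hv2.
set (A := a * b) in *. assert (HA : 0 < A) by (unfold A; nra).
set (lam := Rpower A (/ (P - 1))) in *.
assert (Hlam : 0 < lam) by apply Rpower_pos.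
assert (HlamA : Rpower lam (P - 1) = A) by (apply Rpower_inv_base; lra).
set (k := a - b). assert (Hk : 0 < k) by (unfold k; lra).
set (c0 := (P - 1) * A). assert (Hc0 : 0 < c0) by (unfold c0; nra).
set (phi := fun t => y1 t - y2 t). set (psi := fun t => v1 t - v2 t).
set (rho := fun t => P * A * phi t - (Rpower (y1 t) P - Rpower (y2 t) P)
                     - exp (- nu * t) * (Rpower (y1 t) Q - Rpower (y2 t) Q)).
assert (Hphi : forall t, is_derive phi t (psi t)).
{ intros t. apply is_derive_Rminus; [apply Hs1|apply Hs2]. }
assert (Hpsi : forall t, is_derive psi t (k * psi t - c0 * phi t + rho t)).
{ intros t. eapply is_derive_val.
  - apply is_derive_Rminus; [apply Hs1|apply Hs2].
  - cbv beta. rewrite Rmult_0_l, exp_0. unfold rho, psi, phi, c0, k. fold A. ring. }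
(* The linear part of y^P at lam has coefficient P * A, and the other power
   carries a decaying factor. *)
assert (Hrho : forall eta, 0 < eta -> exists T, 0 <= T /\ forall t, T <= t -> Rabs (rho t) <= eta * Rabs (phi t)).
{ intros eta Heta.
  assert (Hpc : continuous (fun x => Rpower x (P - 1)) lam).
  { apply (is_derive_continuous _ _ ((P - 1) * Rpower lam (P - 1 - 1))).
    apply is_derive_Reals, derivable_pt_lim_power, Hlam. }
  destruct (proj1 (continuous_eps _ _) Hpc (eta / (2 * P))) as [d [Hd0 Hd]]; [apply Rdiv_lt_0_compat; lra|].
  set (d' := Rmin d (lam / 2)). assert (Hd' : 0 < d') by (apply Rmin_glb_lt; lra).
  destruct (Hy1 d' Hd') as [T1 [HT1 B1]]. destruct (Hy2 d' Hd') as [T2 [HT2 B2]].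
  set (CQ := Q * Rpower (2 * lam) (Q - 1)).
  assert (HCQ : 0 < CQ) by (apply Rmult_lt_0_compat; [lra|apply Rpower_pos]).
  destruct (exp_decay nu Hnu (eta / (2 * CQ))) as [T3 [HT3 B3]]; [apply Rdiv_lt_0_compat; lra|].
  exists (T1 + T2 + T3). split; [lra|]. intros t Ht.
  specialize (B1 t ltac:(lra)). specialize (B2 t ltac:(lra)). specialize (B3 t ltac:(lra)).
  rewrite Rminus_0_r, Rabs_pos_eq in B3 by apply Rlt_le, exp_pos.
  assert (Hd1 : d' <= d) by apply Rmin_l. assert (Hd2 : d' <= lam / 2) by apply Rmin_r.
  apply Rabs_def2 in B1. apply Rabs_def2 in B2.
  destruct (Rpower_mean_value (y1 t) (y2 t) P) as [c [Hc Ec]]; [lra|lra|].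
  assert (Hc' : Rabs (c - lam) < d).
  { assert (lam - d' < Rmin (y1 t) (y2 t)) by (apply Rmin_glb_lt; lra).
    assert (Rmax (y1 t) (y2 t) < lam + d') by (apply Rmax_lub_lt; lra).
    apply Rabs_def1; lra. }
  assert (B4 := Hd c Hc'). rewrite HlamA in B4.
  assert (B5 := Rpower_lipschitz (y1 t) (y2 t) (2 * lam) Q HQ ltac:(lra) ltac:(lra)).
  fold CQ in B5. fold (phi t) in B5, Ec. assert (Hp := Rabs_pos (phi t)).
  unfold rho. rewrite Ec.
  replace (P * A * phi t - P * Rpower c (P - 1) * phi t - exp (- nu * t) * (Rpower (y1 t) Q - Rpower (y2 t) Q))
   with (- (P * (Rpower c (P - 1) - A) * phi t) - exp (- nu * t) * (Rpower (y1 t) Q - Rpower (y2 t) Q)) by ring.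
  eapply Rle_trans; [apply Rabs_triang|]. rewrite !Rabs_Ropp, !Rabs_mult, (Rabs_pos_eq P), (Rabs_pos_eq (exp _)) by (lra || apply Rlt_le, exp_pos).
  assert (P * Rabs (Rpower c (P - 1) - A) <= eta / 2).
  { apply Rmult_lt_compat_l with (r := P) in B4; [|lra].
    replace (P * (eta / (2 * P))) with (eta / 2) in B4 by (field; lra). lra. }
  assert (exp (- nu * t) * Rabs (Rpower (y1 t) Q - Rpower (y2 t) Q) <= eta / (2 * CQ) * (CQ * Rabs (phi t))).
  { apply Rmult_le_compat; [apply Rlt_le, exp_pos|apply Rabs_pos|lra|exact B5]. }
  replace (eta / (2 * CQ) * (CQ * Rabs (phi t))) with (eta / 2 * Rabs (phi t)) in H0 by (field; lra).
  nra. }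
(* The bounds on g let k psi^2 and g c0 phi^2 absorb the cross terms and keep H
   definite. *)
set (g := Rmin (k / (2 * (1 + k ^ 2 / c0))) (Rmin 1 (c0 / 4))).
assert (Hkc : 0 < k ^ 2 / c0) by (apply Rdiv_lt_0_compat; [apply pow_lt; lra|lra]).
assert (Hg : 0 < g).
{ apply Rmin_glb_lt; [apply Rdiv_lt_0_compat; lra|apply Rmin_glb_lt; lra]. }
assert (Hg1 : g * (1 + k ^ 2 / c0) <= k / 2).
{ apply Rle_trans with (k / (2 * (1 + k ^ 2 / c0)) * (1 + k ^ 2 / c0)).
  - apply Rmult_le_compat_r; [lra|apply Rmin_l].
  - right. field. split; [lra|]. assert (0 <= k ^ 2) by apply pow2_ge_0. lra. }
assert (Hg2 : g <= 1) by (eapply Rle_trans; [apply Rmin_r|apply Rmin_l]).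
assert (Hg3 : g <= c0 / 4) by (eapply Rle_trans; [apply Rmin_r|apply Rmin_r]).
assert (Hg4 : g ^ 2 <= c0 / 4) by nra.
set (eta := Rmin k (Rmin (g * c0 / 2) (c0 / 2))).
assert (Hgc : 0 < g * c0) by (apply Rmult_lt_0_compat; lra).
assert (Heta : 0 < eta) by (repeat apply Rmin_glb_lt; lra).
assert (He1 : eta <= k) by apply Rmin_l.
assert (He2 : eta <= g * c0 / 2) by (eapply Rle_trans; [apply Rmin_r|apply Rmin_l]).
assert (He3 : eta <= c0 / 2) by (eapply Rle_trans; [apply Rmin_r|apply Rmin_r]).
destruct (Hrho eta Heta) as [T [HT HrT]].
set (H := fun t => psi t ^ 2 / 2 - (- c0) * phi t ^ 2 / 2 - g * (phi t * psi t)).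
set (dH := fun t => psi t * (k * psi t - c0 * phi t + rho t) - (- c0) * (phi t * psi t)
             - g * (psi t * psi t + phi t * (k * psi t - c0 * phi t + rho t))).
assert (HdH : forall t, is_derive H t (dH t)).
{ intros t. apply is_derive_Rminus; [exact (is_derive_kinetic (- c0) phi psi t _ (Hphi t) (Hpsi t))|].
  apply is_derive_Rscal, is_derive_Rmult; auto. }
assert (HdH0 : forall t, T <= t -> 0 <= dH t).
{ intros t Ht. specialize (HrT t Ht). unfold dH.
  set (x := phi t) in *. set (z := psi t) in *. set (r := rho t) in *.
  assert (Hx2 : Rabs x ^ 2 = x ^ 2) by apply pow2_abs.
  assert (Hz2 : Rabs z ^ 2 = z ^ 2) by apply pow2_abs.
  assert (Px := Rabs_pos x). assert (Pz := Rabs_pos z).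
  assert (R1 : Rabs (r * z) <= eta * (x ^ 2 / 2 + z ^ 2 / 2)).
  { rewrite Rabs_mult, <- Hx2, <- Hz2.
    apply Rle_trans with (eta * Rabs x * Rabs z); [apply Rmult_le_compat_r; lra|].
    rewrite Rmult_assoc. apply Rmult_le_compat_l; [lra|].
    assert (0 <= (Rabs x - Rabs z) ^ 2) by apply pow2_ge_0. lra. }
  assert (R2 : Rabs (x * r) <= eta * x ^ 2).
  { rewrite Rabs_mult, <- Hx2. nra. }
  assert (R3 : k * (x * z) <= c0 / 4 * x ^ 2 + k ^ 2 / c0 * z ^ 2).
  { assert (E : c0 / 4 * x ^ 2 + k ^ 2 / c0 * z ^ 2 - k * (x * z) = / c0 * (c0 * x / 2 - k * z) ^ 2) by (field; lra).
    assert (0 <= / c0 * (c0 * x / 2 - k * z) ^ 2); [|lra].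
    apply Rmult_le_pos; [apply Rlt_le, Rinv_0_lt_compat; lra|apply pow2_ge_0]. }
  apply Rabs_le_between in R1. apply Rabs_le_between in R2.
  assert (S1 : g * (k * (x * z)) <= g * (c0 / 4 * x ^ 2 + k ^ 2 / c0 * z ^ 2)) by (apply Rmult_le_compat_l; lra).
  assert (S2 : g * (x * r) <= g * (eta * x ^ 2)) by (apply Rmult_le_compat_l; lra).
  assert (Qx : 0 <= x ^ 2) by apply pow2_ge_0. assert (Qz : 0 <= z ^ 2) by apply pow2_ge_0.
  assert (S3 : (g * (1 + k ^ 2 / c0)) * z ^ 2 <= k / 2 * z ^ 2) by (apply Rmult_le_compat_r; lra).
  assert (S4 : eta * z ^ 2 <= k * z ^ 2) by (apply Rmult_le_compat_r; lra).
  assert (S5 : eta * x ^ 2 <= g * c0 / 2 * x ^ 2) by (apply Rmult_le_compat_r; lra).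
  assert (S6 : g * (eta * x ^ 2) <= g * (c0 / 2 * x ^ 2)).
  { apply Rmult_le_compat_l; [lra|]. apply Rmult_le_compat_r; lra. }
  replace (z * (k * z - c0 * x + r) - - c0 * (x * z) - g * (z * z + x * (k * z - c0 * x + r)))
    with (k * z ^ 2 + r * z - g * z ^ 2 - g * (k * (x * z)) + g * c0 * x ^ 2 - g * (x * r)) by ring.
  lra. }
assert (Hlow : forall t, psi t ^ 2 / 4 + c0 * phi t ^ 2 / 4 <= H t).
{ intros t. unfold H. set (x := phi t). set (z := psi t).
  assert (0 <= (z / 2 - g * x) ^ 2) by apply pow2_ge_0.
  assert (0 <= x ^ 2) by apply pow2_ge_0. nra. }
assert (Hphi0 : tends_to phi 0).
{ intros eps He. destruct (Hy1 (eps / 2)) as [U1 [PU1 W1]]; [lra|].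
  destruct (Hy2 (eps / 2)) as [U2 [PU2 W2]]; [lra|].
  exists (U1 + U2). split; [lra|]. intros t Ht. specialize (W1 t ltac:(lra)). specialize (W2 t ltac:(lra)).
  unfold phi. apply Rabs_def2 in W1. apply Rabs_def2 in W2. apply Rabs_def1; lra. }
assert (Hpsi0 : tends_to psi 0) by (now apply tends_to_minus).
exists T. intros t Ht.
assert (HHt : H t <= 0).
{ apply le_epsilon. intros eps He. rewrite Rplus_0_l.
  set (K := 1 / 2 + c0 / 2 + g). set (e := Rmin 1 (eps / K)).
  assert (HK : 0 < K) by (unfold K; lra).
  assert (He0 : 0 < e) by (apply Rmin_glb_lt; [lra|apply Rdiv_lt_0_compat; lra]).
  destruct (Hphi0 e He0) as [U1 [PU1 W1]]. destruct (Hpsi0 e He0) as [U2 [PU2 W2]].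
  set (s := t + U1 + U2 + 1 + Rabs t).
  assert (Ts : t <= s /\ U1 <= s /\ U2 <= s).
  { unfold s. assert (Z := Rabs_pos t). assert (Z1 := Rle_abs (- t)). rewrite Rabs_Ropp in Z1. lra. }
  destruct Ts as [Ts1 [Ts2 Ts3]].
  specialize (W1 s Ts2). specialize (W2 s Ts3). rewrite Rminus_0_r in W1, W2.
  apply Rle_trans with (H s).
  { apply (nondecreasing_of_derive H dH t s Ts1); [intros u _; apply HdH|].
    intros u Hu. apply HdH0. lra. }
  assert (E1 : phi s ^ 2 <= e).
  { rewrite <- pow2_abs. assert (Z := Rabs_pos (phi s)). assert (e <= 1) by apply Rmin_l. nra. }
  assert (E2 : psi s ^ 2 <= e).
  { rewrite <- pow2_abs. assert (Z := Rabs_pos (psi s)). assert (e <= 1) by apply Rmin_l. nra. }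
  assert (E3 : - (phi s * psi s) <= e).
  { assert (0 <= (phi s + psi s) ^ 2) by apply pow2_ge_0. nra. }
  assert (E4 : K * e <= eps).
  { apply Rle_trans with (K * (eps / K)); [apply Rmult_le_compat_l; [lra|apply Rmin_r]|].
    right. field. lra. }
  unfold H. unfold K in E4. nra. }
assert (Hl := Hlow t).
assert (Q1 : 0 <= psi t ^ 2) by apply pow2_ge_0.
assert (Q2 : 0 <= phi t ^ 2) by apply pow2_ge_0.
assert (Hsq : forall x, x ^ 2 <= 0 -> x = 0).
{ intros x Hx. apply Rsqr_0_uniq. rewrite Rsqr_pow2. assert (Z := pow2_ge_0 x). lra. }
assert (Z1 : phi t = 0) by (apply Hsq; nra). assert (Z2 : psi t = 0) by (apply Hsq; nra).
unfold phi in Z1. unfold psi in Z2. split; lra.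
Qed.

(** That y does not tend to 0 at +oo: for rescaled profiles this is being singular
at the end of the half-line under consideration. *)
Definition frequently_large (y : R -> R) : Prop :=
  exists c, 0 < c /\ forall T, exists t, T <= t /\ c <= y t.

Lemma persistent_solution_limit (a b nu P Q : R) (y v : R -> R) :
  0 < b -> b < a -> 0 < nu -> 1 < P -> 1 < Q ->
  solves a b 0 nu P Q y v -> frequently_large y ->
  tends_to y (Rpower (a * b) (/ (P - 1))) /\ tends_to v 0.
Proof.
intros Hb Hab Hnu HP HQ Hs [c [Hc Hfreq]].
assert (Hy : forall t, 0 < y t) by (intros t; apply Hs).
set (C := Rpower ((a + b) * exp (a + b + b * P)) (/ (P - 1))).
assert (HC := solution_bound a b nu P Q y v ltac:(lra) Hb HP Hs). fold C in HC.
assert (Hup := slope_upper a b 0 nu P Q y v ltac:(lra) Hs).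
assert (Hlo := slope_lower a b 0 nu P Q y v ltac:(lra) Hs).
assert (HCp : 0 < C) by apply Rpower_pos.
destruct (solution_settles a b nu P Q 0 C ((a + b) * C) y v) as [Hv Hh]; try lra.
{ intros t _. split; [apply Hs|split; [apply HC|]].
  specialize (Hup t). specialize (Hlo t). specialize (HC t). specialize (Hy t).
  apply Rabs_le. split; nra. }
split; [|exact Hv].
destruct (balance_persistence y (a * b) P c) as [m [T [Hm [HT HmT]]]]; try assumption; [nra| |].
{ intros t. apply (is_derive_continuous y t (v t)), Hs. }
apply (balance_limit y (a * b) P m T); try assumption. nra.
Qed.

Lemma persistent_solution_unique (a b nu P Q : R) (y1 v1 y2 v2 : R -> R) :
  0 < b -> b < a -> 0 < nu -> 1 < P -> 1 < Q ->
  solves a b 0 nu P Q y1 v1 -> frequently_large y1 ->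
  solves a b 0 nu P Q y2 v2 -> frequently_large y2 ->
  forall t, y1 t = y2 t.
Proof.
intros Hb Hab Hnu HP HQ Hs1 Hf1 Hs2 Hf2 t.
destruct (persistent_solution_limit a b nu P Q y1 v1) as [L1 V1]; try assumption.
destruct (persistent_solution_limit a b nu P Q y2 v2) as [L2 V2]; try assumption.
destruct (eventual_uniqueness a b nu P Q y1 v1 y2 v2) as [T HT]; try assumption.
destruct (HT (Rmax t T) (Rmax_r _ _)) as [E1 E2].
assert (B1 := solution_bound a b nu P Q y1 v1 ltac:(lra) Hb HP Hs1).
assert (B2 := solution_bound a b nu P Q y2 v2 ltac:(lra) Hb HP Hs2).
apply (truncated_solution_unique a b 0 nu P Q (Rpower ((a + b) * exp (a + b + b * P)) (/ (P - 1)))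
  (Rmax t T) y1 v1 y2 v2 (Rpower_pos _ _) HP HQ); try assumption;
  now apply truncated_solution_of_solves.
Qed.

(** * Confinement by negative energy *)

Lemma energy_ext (a b mu nu P Q : R) (y v y' v' : R -> R) (t : R) :
  y t = y' t -> v t = v' t -> energy a b mu nu P Q y v t = energy a b mu nu P Q y' v' t.
Proof. intros H1 H2. unfold energy. now rewrite H1, H2. Qed.

(** A rescaled solution has an energy with the factor exp (- 2 th t), up to which
it is bounded whenever the original solution is. *)
Lemma energy_shift (th a b mu nu P Q : R) (y v : R -> R) (t : R) :
  0 < y t ->
  energy (a - th) (b + th) (mu + (P - 1) * th) (nu - (Q - 1) * th) P Q
    (fun s => exp (- th * s) * y s) (fun s => exp (- th * s) * (v s - th * y s)) t
  = exp (- (2 * th) * t) *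
    ((v t - th * y t) ^ 2 / 2 - (a - th) * (b + th) * y t ^ 2 / 2
     + exp (mu * t) * (Rpower (y t) (P + 1) / (P + 1))
     + exp (- nu * t) * (Rpower (y t) (Q + 1) / (Q + 1))).
Proof.
intros Hy. unfold energy. rewrite !Rpower_exp_mult by exact Hy.
assert (E2 : exp (- (2 * th) * t) = exp (- th * t) ^ 2).
{ simpl. rewrite Rmult_1_r, <- exp_plus. f_equal. ring. }
assert (E3 : exp ((mu + (P - 1) * th) * t) * exp ((P + 1) * (- th * t)) = exp (- th * t) ^ 2 * exp (mu * t)).
{ simpl. rewrite Rmult_1_r, <- !exp_plus. f_equal. ring. }
assert (E4 : exp (- (nu - (Q - 1) * th) * t) * exp ((Q + 1) * (- th * t)) = exp (- th * t) ^ 2 * exp (- nu * t)).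
{ simpl. rewrite Rmult_1_r, <- !exp_plus. f_equal. ring. }
rewrite E2. unfold Rdiv.
replace (exp ((mu + (P - 1) * th) * t) * (exp ((P + 1) * (- th * t)) * Rpower (y t) (P + 1) * / (P + 1)))
  with (exp (- th * t) ^ 2 * exp (mu * t) * (Rpower (y t) (P + 1) * / (P + 1))) by (rewrite <- E3; ring).
replace (exp (- (nu - (Q - 1) * th) * t) * (exp ((Q + 1) * (- th * t)) * Rpower (y t) (Q + 1) * / (Q + 1)))
  with (exp (- th * t) ^ 2 * exp (- nu * t) * (Rpower (y t) (Q + 1) * / (Q + 1))) by (rewrite <- E4; ring).
ring.
Qed.

(** The positive zero of the potential - A x^2 / 2 + x^(P + 1) / (P + 1). *)
Definition well_radius (A P : R) : R := Rpower ((P + 1) * A / 2) (/ (P - 1)).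

Lemma well_radius_bound (A P y : R) :
  1 < P -> 0 < y -> Rpower y (P + 1) / (P + 1) < A * y ^ 2 / 2 -> y < well_radius A P.
Proof.
intros HP Hy H.
rewrite (Rpower_mult_base y (P + 1) Hy) in H. replace (P + 1 - 1) with P in H by ring.
rewrite (Rpower_mult_base y P Hy) in H.
assert (H1 : Rpower y (P - 1) < (P + 1) * A / 2).
{ apply Rmult_lt_reg_l with (y ^ 2 / (P + 1)); [apply Rdiv_lt_0_compat; [apply pow_lt|]; lra|].
  replace (y ^ 2 / (P + 1) * Rpower y (P - 1)) with (y * (y * Rpower y (P - 1)) / (P + 1)) by (field; lra).
  replace (y ^ 2 / (P + 1) * ((P + 1) * A / 2)) with (A * y ^ 2 / 2) by (field; lra). exact H. }
replace y with (Rpower (Rpower y (P - 1)) (/ (P - 1))).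
- apply Rpower_lt_base; [apply Rinv_0_lt_compat; lra|apply Rpower_pos|exact H1].
- rewrite Rpower_mult, Rinv_r by lra. now apply Rpower_1.
Qed.

Lemma negative_energy (a b mu nu P Q : R) (y v : R -> R) (e t : R) :
  0 < a * b -> 1 < P -> 1 < Q -> 0 <= e -> 0 < y t -> energy a b mu nu P Q y v t < - e ->
  2 * e < a * b * y t ^ 2 /\ v t ^ 2 < a * b * y t ^ 2 /\
  exp (mu * t) * (Rpower (y t) (P + 1) / (P + 1)) < a * b * y t ^ 2 / 2 /\
  exp (- nu * t) * (Rpower (y t) (Q + 1) / (Q + 1)) < a * b * y t ^ 2 / 2.
Proof.
intros Hab HP HQ He Hy HE. unfold energy in HE.
assert (H1 : 0 < exp (mu * t) * (Rpower (y t) (P + 1) / (P + 1))).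
{ apply Rmult_lt_0_compat; [apply exp_pos|apply Rdiv_lt_0_compat; [apply Rpower_pos|lra]]. }
assert (H2 : 0 < exp (- nu * t) * (Rpower (y t) (Q + 1) / (Q + 1))).
{ apply Rmult_lt_0_compat; [apply exp_pos|apply Rdiv_lt_0_compat; [apply Rpower_pos|lra]]. }
assert (H3 := pow2_ge_0 (v t)). repeat split; lra.
Qed.

Lemma continuous_le_right (f : R -> R) (t N c : R) :
  t < N -> continuous f t -> (forall s, t < s <= N -> f s <= c) -> f t <= c.
Proof.
intros HtN Hf H. apply Rnot_lt_le. intros Hbad.
destruct (proj1 (continuous_eps f t) Hf (f t - c)) as [d [Hd0 Hd]]; [lra|].
set (h := Rmin (d / 2) (N - t)).
assert (Hh : 0 < h) by (apply Rmin_glb_lt; lra).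
assert (Hh1 : h <= d / 2) by apply Rmin_l. assert (Hh2 : h <= N - t) by apply Rmin_r.
assert (B := Hd (t + h)). replace (t + h - t) with h in B by ring.
rewrite Rabs_pos_eq in B by lra. specialize (B ltac:(lra)). apply Rabs_def2 in B.
assert (B1 := H (t + h) ltac:(lra)). lra.
Qed.

(** The energy cannot increase backward while 0 < x < M.  Negative energy excludes
both x = 0, where the energy is at least 0, and x = M, where the potential
vanishes, so neither boundary value is reached. *)
Lemma negative_energy_confines (a b mu P Q N : R) (x v : R -> R) :
  let M := well_radius (a * b) Q in
  b <= a -> 0 < a * b -> 0 <= mu -> 1 < P -> 1 < Q ->
  truncated_solution a b mu 0 P Q M x v ->
  0 < x N -> energy a b mu 0 P Q x v N < 0 ->
  forall t, t <= N -> 0 < x t < M.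
Proof.
intros M Hba Hab Hmu HP HQ Hsol HxN HEN t Ht.
assert (HM : 0 < M) by apply Rpower_pos.
assert (Hx : forall s, continuous x s) by (intros s; apply (is_derive_continuous _ _ _ (proj1 (Hsol s)))).
assert (Hwell : forall s, 0 < x s -> energy a b mu 0 P Q x v s < 0 -> x s < M).
{ intros s Hs HE. apply well_radius_bound; [exact HQ|exact Hs|].
  destruct (negative_energy a b mu 0 P Q x v 0 s) as [_ [_ [_ H]]]; try assumption; [lra|lra|].
  replace (- 0 * s) with 0 in H by ring. rewrite exp_0, Rmult_1_l in H. exact H. }
assert (Hmono : forall s1 s2, s1 <= s2 -> (forall s, s1 <= s <= s2 -> 0 < x s <= M) ->
   energy a b mu 0 P Q x v s1 <= energy a b mu 0 P Q x v s2).
{ intros s1 s2 Hs Hin.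
  apply (nondecreasing_of_derive _ (fun t => (a - b) * v t ^ 2 + mu * (exp (mu * t) * (Rpower (x t) (P + 1) / (P + 1)))
     - 0 * (exp (- 0 * t) * (Rpower (x t) (Q + 1) / (Q + 1)))) s1 s2 Hs).
  - intros s Hs'. apply is_derive_energy; [lra|lra|].
    apply (solves_at_of_truncated a b mu 0 P Q M); [exact Hsol|now apply Hin].
  - intros s _. rewrite Rmult_0_l, Rminus_0_r.
    apply Rplus_le_le_0_compat; [apply Rmult_le_pos; [lra|apply pow2_ge_0]|].
    apply Rmult_le_pos; [exact Hmu|]. apply Rlt_le, Rmult_lt_0_compat; [apply exp_pos|].
    apply Rdiv_lt_0_compat; [apply Rpower_pos|lra]. }
set (g := fun s => Rmax (x s - M) (- x s)).
assert (Hg : forall s, g s < 0 <-> 0 < x s < M).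
{ intros s. unfold g. split.
  - intros H. assert (H1 := Rmax_l (x s - M) (- x s)). assert (H2 := Rmax_r (x s - M) (- x s)). lra.
  - intros H. apply Rmax_lub_lt; lra. }
apply Hg. apply (backward_continuation g N t); [| | |lra].
- intros s _. apply continuous_eps. intros eps Heps.
  destruct (proj1 (continuous_eps x s) (Hx s) eps Heps) as [d [Hd0 Hd]].
  exists d. split; [exact Hd0|]. intros r Hr. specialize (Hd r Hr).
  unfold g, Rmax. apply Rabs_def2 in Hd.
  destruct (Rle_dec (x r - M) (- x r)); destruct (Rle_dec (x s - M) (- x s)); apply Rabs_def1; lra.
- apply Hg. split; [exact HxN|now apply Hwell].
- intros s Hs Hin. apply Hg.
  assert (Hin' : forall r, s < r <= N -> 0 < x r < M) by (intros r Hr; apply Hg, Hin, Hr).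
  set (e := - energy a b mu 0 P Q x v N / 2).
  assert (He : 0 < e) by (unfold e; lra).
  (* Energy below - e forces a b x^2 > 2 e, a bound that survives the limit at s. *)
  set (m := sqrt (2 * e / (a * b))).
  assert (Hm : 0 < m) by (apply sqrt_lt_R0, Rdiv_lt_0_compat; lra).
  assert (Hm2 : m ^ 2 = 2 * e / (a * b)) by (apply pow2_sqrt, Rlt_le, Rdiv_lt_0_compat; lra).
  assert (Hlow : forall r, s < r <= N -> - x r <= - m).
  { intros r Hr. apply Ropp_le_contravar. apply Rnot_lt_le. intros Hlt.
    assert (HEr := Hmono r N ltac:(lra) ltac:(intros r' Hr'; assert (Z := Hin' r' ltac:(lra)); lra)).
    destruct (negative_energy a b mu 0 P Q x v e r) as [H1 _]; try assumption; try lra.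
    - apply Hin', Hr.
    - unfold e. lra.
    - assert (Hxr := Hin' r Hr).
      assert (x r ^ 2 < m ^ 2) by (simpl; nra). rewrite Hm2 in H.
      apply Rmult_lt_compat_l with (r := a * b) in H; [|lra].
      replace (a * b * (2 * e / (a * b))) with (2 * e) in H by (field; split; nra). lra. }
  assert (Hxs1 : - x s <= - m).
  { apply (continuous_le_right (fun r => - x r) s N); [lra| |exact Hlow].
    apply (continuous_opp x), Hx. }
  assert (Hxs2 : x s <= M).
  { apply (continuous_le_right x s N); [lra|apply Hx|]. intros r Hr. apply Rlt_le, Hin', Hr. }
  split; [lra|]. apply Hwell; [lra|].
  eapply Rle_lt_trans; [apply (Hmono s N); [lra|]|exact HEN].
  intros r Hr. destruct (Req_dec r s) as [->|Hne]; [lra|]. assert (Z := Hin' r ltac:(lra)). lra.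
Qed.

(** Damping lowers the energy backward, and the decaying potential can raise it by
at most its own size, which the bound y < well_radius makes exponentially
small. *)
Lemma negative_energy_persists (a b nu P Q T N e : R) (y v : R -> R) :
  b <= a -> 0 < a * b -> 0 < nu -> 1 < P -> 1 < Q -> 0 <= e -> T <= N ->
  (forall t, t <= N -> solves_at a b 0 nu P Q y v t) ->
  energy a b 0 nu P Q y v N
    + Rpower (well_radius (a * b) P) (Q + 1) / (Q + 1) * exp (- nu * T) < - e ->
  forall t, T <= t <= N -> energy a b 0 nu P Q y v t < - e.
Proof.
intros Hba Hab Hnu HP HQ He HTN Hsol HEN t Ht.
set (W := well_radius (a * b) P) in *. set (C := Rpower W (Q + 1) / (Q + 1)) in *.
assert (HW : 0 < W) by apply Rpower_pos.
assert (HC : 0 < C) by (apply Rdiv_lt_0_compat; [apply Rpower_pos|lra]).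
set (E := energy a b 0 nu P Q y v) in *.
assert (HE : forall s, s <= N -> is_derive E s ((a - b) * v s ^ 2 + 0 * (exp (0 * s) * (Rpower (y s) (P + 1) / (P + 1)))
     - nu * (exp (- nu * s) * (Rpower (y s) (Q + 1) / (Q + 1))))).
{ intros s Hs. apply is_derive_energy; [lra|lra|now apply Hsol]. }
enough (E t + e < 0) by lra.
apply (backward_continuation (fun s => E s + e) N T); [| | |exact Ht].
- intros s Hs. apply (continuous_plus E (fun _ => e)); [|apply continuous_const].
  apply (is_derive_continuous _ _ _ (HE s (proj2 Hs))).
- assert (0 < C * exp (- nu * T)) by (apply Rmult_lt_0_compat; [exact HC|apply exp_pos]). lra.
- intros s Hs Hin.
  assert (HyW : forall r, s < r <= N -> y r <= W).
  { intros r Hr. apply Rlt_le, well_radius_bound; [exact HP|apply Hsol; lra|].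
    destruct (negative_energy a b 0 nu P Q y v 0 r) as [_ [_ [H _]]]; try assumption; try lra.
    - apply Hsol; lra.
    - specialize (Hin r Hr). cbv beta in Hin. unfold E in Hin. lra.
    - rewrite Rmult_0_l, exp_0, Rmult_1_l in H. exact H. }
  assert (Hys : y s <= W).
  { apply (continuous_le_right y s N); [lra| |exact HyW].
    apply (is_derive_continuous y s (v s)), Hsol. lra. }
  assert (Hmono : E s - C * exp (- nu * s) <= E N - C * exp (- nu * N)).
  { apply (nondecreasing_of_derive (fun r => E r - C * exp (- nu * r))
      (fun r => (a - b) * v r ^ 2 + 0 * (exp (0 * r) * (Rpower (y r) (P + 1) / (P + 1)))
     - nu * (exp (- nu * r) * (Rpower (y r) (Q + 1) / (Q + 1))) - C * (- nu * exp (- nu * r))) s N); [lra| |].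
    - intros r Hr. apply is_derive_Rminus; [apply HE; lra|apply is_derive_Rscal, is_derive_exp_lin].
    - intros r Hr.
      assert (Hyr : 0 < y r <= W).
      { split; [apply Hsol; lra|]. destruct (Req_dec r s) as [->|Hne]; [exact Hys|apply HyW; lra]. }
      assert (HB : Rpower (y r) (Q + 1) / (Q + 1) <= C).
      { apply Rmult_le_compat_r; [apply Rlt_le, Rinv_0_lt_compat; lra|apply Rpower_le_base; lra]. }
      assert (Hn := exp_pos (- nu * r)). assert (Hv := pow2_ge_0 (v r)).
      assert (0 <= nu * exp (- nu * r) * (C - Rpower (y r) (Q + 1) / (Q + 1))).
      { apply Rmult_le_pos; [apply Rmult_le_pos; lra|lra]. }
      assert (0 <= (a - b) * v r ^ 2) by (apply Rmult_le_pos; lra). lra. }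
  assert (HN := exp_pos (- nu * N)).
  assert (HT : exp (- nu * s) <= exp (- nu * T)) by (apply exp_le_exp; nra).
  assert (C * exp (- nu * s) <= C * exp (- nu * T)) by (apply Rmult_le_compat_l; lra).
  assert (0 < C * exp (- nu * N)) by (apply Rmult_lt_0_compat; lra). lra.
Qed.

Lemma cluster_point_plane (x v : nat -> R) (K : R) :
  (forall n, Rabs (x n) <= K /\ Rabs (v n) <= K) ->
  exists lx lv, forall eps N, 0 < eps ->
    exists n, (N <= n)%nat /\ Rabs (x n - lx) < eps /\ Rabs (v n - lv) < eps.
Proof.
intros HK.
assert (BW : forall u : nat -> R, (forall n, Rabs (u n) <= K) ->
   exists l, forall eps N, 0 < eps -> exists n, (N <= n)%nat /\ Rabs (u n - l) < eps).
{ intros u Hu. destruct (Bolzano_Weierstrass u (fun z => - K <= z <= K)) as [l Hl].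
  - apply compact_P3.
  - intros n. now apply Rabs_le_between.
  - exists l. intros eps N Heps.
    destruct (Hl (disc l (mkposreal eps Heps)) N) as [n [Hn1 Hn2]].
    + exists (mkposreal eps Heps). intros z Hz. exact Hz.
    + now exists n. }
destruct (BW x) as [lx Hlx]; [intros n; apply HK|].
destruct (functional_choice (fun n m => (n <= m)%nat /\ Rabs (x m - lx) < / INR (S n))) as [f Hf].
{ intros n. apply Hlx. apply Rinv_0_lt_compat, lt_0_INR. lia. }
destruct (BW (fun n => v (f n))) as [lv Hlv]; [intros n; apply HK|].
exists lx, lv. intros eps N Heps.
destruct (archimed_cor1 eps Heps) as [N1 [HN1 HN1']].
destruct (Hlv eps (Nat.max N N1) Heps) as [n [Hn1 Hn2]].
destruct (Hf n) as [Hf1 Hf2].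
exists (f n). split; [lia|split; [|exact Hn2]].
eapply Rlt_trans; [exact Hf2|]. eapply Rle_lt_trans; [|exact HN1].
apply Rinv_le_contravar; [apply lt_0_INR; lia|apply le_INR; lia].
Qed.

(** * Existence of a persistent solution and its limit at the other end *)

Lemma abs_le_of_sqr (x D : R) : 0 <= D -> x ^ 2 <= D ^ 2 -> Rabs x <= D.
Proof.
intros HD H. apply Rnot_lt_le. intros Hlt. rewrite <- (pow2_abs x) in H.
assert (Hp := Rabs_pos x). nra.
Qed.

(** The solution that is at rest at the equilibrium at time N has negative energy in
both scalings, and in the scaling of w its energy stays below a level - e on
[T, N] that does not depend on N; so the resulting bounds are uniform in N. *)
Lemma approximants (a b kappa P Q : R) :
  0 < b -> 0 < kappa -> b + 2 * kappa < a -> 1 < P -> 1 < Q ->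
  let M := well_radius ((a - kappa) * (b + kappa)) Q in
  exists T m W D, 0 < m /\ forall N, T <= N -> exists x v,
    truncated_solution (a - kappa) (b + kappa) ((P - 1) * kappa) 0 P Q M x v /\
    (forall t, t <= N -> 0 < x t < M) /\
    (forall t, T <= t <= N -> m <= exp (kappa * t) * x t <= W /\
       Rabs (exp (kappa * t) * (v t + kappa * x t)) <= D).
Proof.
intros Hb Hk Hab HP HQ M.
set (A := a * b). assert (HA : 0 < A) by (unfold A; nra).
assert (HB : 0 < (a - kappa) * (b + kappa)) by (apply Rmult_lt_0_compat; lra).
assert (HM : 0 < M) by apply Rpower_pos.
set (lam := Rpower A (/ (P - 1))).
assert (Hlam : 0 < lam) by apply Rpower_pos.
assert (HlamA : Rpower lam (P - 1) = A) by (apply Rpower_inv_base; lra).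
assert (HlamP : Rpower lam (P + 1) = A * lam ^ 2).
{ rewrite (Rpower_mult_base lam (P + 1) Hlam). replace (P + 1 - 1) with P by ring.
  rewrite (Rpower_mult_base lam P Hlam), HlamA. ring. }
set (nu := (Q - 1) * kappa). assert (Hnu : 0 < nu) by (unfold nu; nra).
set (W := well_radius A P). assert (HW : 0 < W) by apply Rpower_pos.
set (C := Rpower W (Q + 1) / (Q + 1)).
set (Cl := Rpower lam (Q + 1) / (Q + 1)).
assert (HC : 0 < C) by (apply Rdiv_lt_0_compat; [apply Rpower_pos|lra]).
assert (HCl : 0 < Cl) by (apply Rdiv_lt_0_compat; [apply Rpower_pos|lra]).
(* The bottom lam of the potential well lies at depth 2 e. *)
set (e := A * lam ^ 2 * (P - 1) / (4 * (P + 1))).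
assert (Hl2 : 0 < lam ^ 2) by (apply pow_lt; lra).
assert (He : 0 < e).
{ apply Rdiv_lt_0_compat; [|lra]. repeat apply Rmult_lt_0_compat; lra. }
assert (Hdepth : - (A * lam ^ 2 / 2) + A * lam ^ 2 / (P + 1) = - (2 * e)) by (unfold e; field; lra).
destruct (exp_decay nu Hnu (e / (C + Cl))) as [T [HT HdT]]; [apply Rdiv_lt_0_compat; lra|].
assert (HexpT : forall N, T <= N -> 0 < exp (- nu * N) <= exp (- nu * T) /\ (C + Cl) * exp (- nu * T) < e).
{ intros N HN. split; [split; [apply exp_pos|apply exp_le_exp; nra]|].
  assert (H := HdT T (Rle_refl _)). rewrite Rminus_0_r, Rabs_pos_eq in H by apply Rlt_le, exp_pos.
  apply Rmult_lt_compat_l with (r := C + Cl) in H; [|lra].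
  replace ((C + Cl) * (e / (C + Cl))) with e in H by (field; lra). exact H. }
exists T, (sqrt (2 * e / A)), W, ((1 + A) * W).
split; [apply sqrt_lt_R0, Rdiv_lt_0_compat; lra|].
intros N HN. destruct (HexpT N HN) as [[He1 He2] He3].
assert (HeCl : Cl * exp (- nu * N) <= Cl * exp (- nu * T)) by (apply Rmult_le_compat_l; lra).
assert (HeC0 := exp_pos (- nu * T)).
destruct (truncated_solution_exists (a - kappa) (b + kappa) ((P - 1) * kappa) 0 P Q M N
  (exp (- kappa * N) * lam) (exp (- kappa * N) * (0 - kappa * lam)) HM HP HQ) as [x [v [Hx0 [Hv0 Hsol]]]].
exists x, v. split; [exact Hsol|].
assert (HxN : 0 < x N) by (rewrite Hx0; apply Rmult_lt_0_compat; [apply exp_pos|lra]).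
(* In the scaling of x the momentum at N is - kappa lam, and a - b > 2 kappa is
   what keeps the energy negative all the same. *)
assert (HEz : energy (a - kappa) (b + kappa) ((P - 1) * kappa) 0 P Q x v N < 0).
{ rewrite (energy_ext _ _ _ _ _ _ x v (fun s => exp (- kappa * s) * lam) (fun s => exp (- kappa * s) * (0 - kappa * lam)) N Hx0 Hv0).
  replace ((P - 1) * kappa) with (0 + (P - 1) * kappa) by ring.
  replace 0 with (nu - (Q - 1) * kappa) at 2 by (unfold nu; ring).
  rewrite (energy_shift kappa a b 0 nu P Q (fun _ => lam) (fun _ => 0) N Hlam).
  apply Ropp_lt_cancel. rewrite Ropp_0.
  rewrite Rmult_0_l, exp_0, Rmult_1_l, HlamP. fold Cl.
  rewrite Ropp_mult_distr_r. apply Rmult_lt_0_compat; [apply exp_pos|].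
  assert (Hkk : 0 < kappa * (a - b - 2 * kappa) * lam ^ 2).
  { apply Rmult_lt_0_compat; [apply Rmult_lt_0_compat; lra|lra]. }
  replace (- ((0 - kappa * lam) ^ 2 / 2 - (a - kappa) * (b + kappa) * lam ^ 2 / 2
     + A * lam ^ 2 / (P + 1) + exp (- nu * N) * Cl))
    with (kappa * (a - b - 2 * kappa) * lam ^ 2 / 2 - (- (A * lam ^ 2 / 2) + A * lam ^ 2 / (P + 1))
          - Cl * exp (- nu * N)) by (unfold A; field; lra).
  rewrite Hdepth.
  assert (0 < C * exp (- nu * T)) by (apply Rmult_lt_0_compat; lra). lra. }
assert (Hconf : forall t, t <= N -> 0 < x t < M).
{ apply (negative_energy_confines (a - kappa) (b + kappa) ((P - 1) * kappa) P Q N x v); try assumption; [lra|].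
  apply Rmult_le_pos; lra. }
split; [exact Hconf|].
set (w := fun t => exp (- - kappa * t) * x t).
set (z := fun t => exp (- - kappa * t) * (v t - - kappa * x t)).
assert (Hw : forall t, t <= N -> solves_at a b 0 nu P Q w z t).
{ intros t Ht. assert (Hc := Hconf t Ht).
  assert (H := solves_at_of_truncated _ _ _ _ _ _ _ x v t Hsol ltac:(lra)).
  apply (solves_at_shift (- kappa)) in H. fold w z in H.
  replace (a - kappa - - kappa) with a in H by ring.
  replace (b + kappa + - kappa) with b in H by ring.
  replace ((P - 1) * kappa + (P - 1) * - kappa) with 0 in H by ring.
  replace (0 - (Q - 1) * - kappa) with nu in H by (unfold nu; ring). exact H. }
assert (HwN : w N = lam).
{ unfold w. rewrite Hx0, <- Rmult_assoc, <- exp_plus. replace (- - kappa * N + - kappa * N) with 0 by ring.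
  rewrite exp_0. ring. }
assert (HzN : z N = 0).
{ unfold z. rewrite Hx0, Hv0. ring. }
assert (HEw : energy a b 0 nu P Q w z N + C * exp (- nu * T) < - e).
{ unfold energy. rewrite HwN, HzN, Rmult_0_l, exp_0, Rmult_1_l, HlamP. fold A Cl.
  replace (0 ^ 2 / 2 - A * lam ^ 2 / 2 + A * lam ^ 2 / (P + 1) + exp (- nu * N) * Cl)
    with ((- (A * lam ^ 2 / 2) + A * lam ^ 2 / (P + 1)) + Cl * exp (- nu * N)) by (field; lra).
  rewrite Hdepth. lra. }
assert (HEwt := negative_energy_persists a b nu P Q T N e w z ltac:(lra) HA Hnu HP HQ ltac:(lra) HN Hw HEw).
intros t Ht. specialize (HEwt t Ht).
assert (Hwt : 0 < w t) by (apply Hw; lra).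
destruct (negative_energy a b 0 nu P Q w z e t HA HP HQ ltac:(lra) Hwt HEwt) as [N1 [N2 [N3 _]]].
rewrite Rmult_0_l, exp_0, Rmult_1_l in N3.
assert (HwW : w t < W) by (now apply well_radius_bound).
replace (exp (kappa * t) * x t) with (w t) by (unfold w; rewrite Ropp_involutive; reflexivity).
replace (exp (kappa * t) * (v t + kappa * x t)) with (z t) by (unfold z; rewrite !Ropp_involutive; ring).
split; [split; [|lra]|].
- rewrite <- (Rabs_pos_eq (w t)) by lra. rewrite <- (sqrt_pow2 (Rabs (w t))) by apply Rabs_pos.
  apply sqrt_le_1_alt. rewrite pow2_abs.
  apply Rmult_le_reg_l with A; [exact HA|].
  replace (A * (2 * e / A)) with (2 * e) by (field; lra). fold A in N1. lra.
- apply abs_le_of_sqr; [nra|]. fold A in N2.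
  assert (w t ^ 2 <= W ^ 2) by (apply pow_incr; lra).
  assert (0 <= W ^ 2) by apply pow2_ge_0.
  replace (((1 + A) * W) ^ 2) with (W ^ 2 + 2 * A * W ^ 2 + A ^ 2 * W ^ 2) by ring.
  assert (A * w t ^ 2 <= A * W ^ 2) by (apply Rmult_le_compat_l; lra).
  assert (0 <= A * W ^ 2) by (apply Rmult_le_pos; lra).
  assert (0 <= A ^ 2 * W ^ 2) by (apply Rmult_le_pos; [apply pow2_ge_0|lra]). lra.
Qed.

Lemma le_of_approx (x y K : R) : 0 <= K -> (forall eps, 0 < eps -> x <= y + K * eps) -> x <= y.
Proof.
intros HK H. apply le_epsilon. intros eps He.
eapply Rle_trans; [apply (H (eps / (K + 1))), Rdiv_lt_0_compat; lra|].
apply Rplus_le_compat_l.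
replace eps with ((K + 1) * (eps / (K + 1))) at 2 by (field; lra).
apply Rmult_le_compat_r; [apply Rlt_le, Rdiv_lt_0_compat|]; lra.
Qed.

(** The bounds on the approximants are closed conditions and pass to a cluster
point of their values at T.  The truncation stays inactive in the limit, and
positivity, which may degenerate to x >= 0, is recovered from uniqueness for
the initial value problem. *)
Lemma persistent_solution_exists (a b kappa P Q : R) :
  0 < b -> 0 < kappa -> b + 2 * kappa < a -> 1 < P -> 1 < Q ->
  exists w z, solves a b 0 ((Q - 1) * kappa) P Q w z /\ frequently_large w.
Proof.
intros Hb Hk Hab HP HQ.
destruct (approximants a b kappa P Q Hb Hk Hab HP HQ) as [T [m [W [D [Hm Happ]]]]].
set (M := well_radius ((a - kappa) * (b + kappa)) Q) in *.
assert (HM : 0 < M) by apply Rpower_pos.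
set (sol := truncated_solution (a - kappa) (b + kappa) ((P - 1) * kappa) 0 P Q M) in *.
destruct (functional_choice (fun (n : nat) (p : (R -> R) * (R -> R)) =>
   sol (fst p) (snd p) /\
    (forall t, t <= T + INR n -> 0 < fst p t < M) /\
    (forall t, T <= t <= T + INR n -> m <= exp (kappa * t) * fst p t <= W /\
       Rabs (exp (kappa * t) * (snd p t + kappa * fst p t)) <= D))) as [F HF].
{ intros n. destruct (Happ (T + INR n)) as [x [v H]]; [assert (H0 := pos_INR n); lra|].
  exists (x, v). exact H. }
set (X := fun n => fst (F n)). set (V := fun n => snd (F n)).
assert (HD : 0 <= D).
{ destruct (HF O) as [_ [_ H]]. destruct (H T) as [_ H1]; [simpl; lra|].
  eapply Rle_trans; [apply Rabs_pos|exact H1]. }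
set (K := M + (exp (- (kappa * T)) * D + kappa * M)).
destruct (cluster_point_plane (fun n => X n T) (fun n => V n T) K) as [lx [lv Hcl]].
{ intros n. destruct (HF n) as [_ [H1 H2]]. fold (X n) (V n) in H1, H2.
  assert (Hn := pos_INR n).
  specialize (H1 T ltac:(lra)). destruct (H2 T ltac:(lra)) as [_ H3].
  assert (He := exp_pos (- (kappa * T))).
  assert (HeD : 0 <= exp (- (kappa * T)) * D) by (apply Rmult_le_pos; lra).
  assert (HkX : 0 < kappa * X n T < kappa * M) by nra.
  split.
  - rewrite Rabs_pos_eq by lra. unfold K. lra.
  - assert (H4 : Rabs (V n T + kappa * X n T) <= exp (- (kappa * T)) * D).
    { rewrite Rabs_mult, (Rabs_pos_eq (exp _)) in H3 by apply Rlt_le, exp_pos.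
      apply Rmult_le_compat_l with (r := exp (- (kappa * T))) in H3; [|lra].
      rewrite <- Rmult_assoc, <- exp_plus, Rplus_opp_l, exp_0, Rmult_1_l in H3. exact H3. }
    apply Rabs_le_between in H4. apply Rabs_le. unfold K. lra. }
destruct (truncated_solution_exists (a - kappa) (b + kappa) ((P - 1) * kappa) 0 P Q M T lx lv HM HP HQ)
  as [Z [VZ [HZ0 [HVZ0 HZ]]]].
(* Continuous dependence turns the cluster point at T into one at each time t. *)
assert (Hclt : forall t eps, 0 < eps -> exists n, t <= T + INR n /\
   Rabs (X n t - Z t) < eps /\ Rabs (V n t - VZ t) < eps).
{ intros t eps Heps.
  destruct (truncated_dependence (a - kappa) (b + kappa) ((P - 1) * kappa) 0 P Q M T t HM HP HQ) as [G [HG Hdep]].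
  destruct (INR_unbounded (t - T)) as [N0 HN0].
  set (d := Rmin 1 (eps ^ 2 / (4 * G))).
  assert (He2 : 0 < eps ^ 2) by (apply pow_lt; lra).
  assert (Hd : 0 < d) by (apply Rmin_glb_lt; [lra|apply Rdiv_lt_0_compat; lra]).
  destruct (Hcl d N0 Hd) as [n [Hn [B1 B2]]].
  exists n. assert (HnN : INR N0 <= INR n) by (now apply le_INR).
  split; [lra|].
  specialize (Hdep (X n) (V n) Z VZ (proj1 (HF n)) HZ). rewrite HZ0, HVZ0 in Hdep.
  assert (Hd1 : d <= 1) by apply Rmin_l.
  assert (Hd2 : d * (4 * G) <= eps ^ 2).
  { replace (eps ^ 2) with (eps ^ 2 / (4 * G) * (4 * G)) by (field; lra).
    apply Rmult_le_compat_r; [lra|apply Rmin_r]. }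
  assert (S1 : (X n T - lx) ^ 2 <= d).
  { rewrite <- pow2_abs. assert (Z1 := Rabs_pos (X n T - lx)). nra. }
  assert (S2 : (V n T - lv) ^ 2 <= d).
  { rewrite <- pow2_abs. assert (Z1 := Rabs_pos (V n T - lv)). nra. }
  assert (S3 : ((X n T - lx) ^ 2 + (V n T - lv) ^ 2) * G <= (2 * d) * G) by (apply Rmult_le_compat_r; lra).
  assert (S4 := pow2_ge_0 (X n t - Z t)). assert (S5 := pow2_ge_0 (V n t - VZ t)).
  assert (HdG : 0 < d * G) by (apply Rmult_lt_0_compat; lra).
  assert (Hhalf : forall x, x ^ 2 <= eps ^ 2 / 2 -> Rabs x < eps).
  { intros x Hx. apply Rnot_le_lt. intros Hle. rewrite <- (pow2_abs x) in Hx. nra. }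
  split; apply Hhalf; lra. }
assert (HZ01 : forall t, 0 <= Z t <= M).
{ intros t. split.
  - apply (le_of_approx 0 (Z t) 1); [lra|]. intros eps He.
    destruct (Hclt t eps He) as [n [Hn [B1 _]]]. destruct (HF n) as [_ [H1 _]].
    specialize (H1 t Hn). fold (X n) in H1. apply Rabs_def2 in B1. lra.
  - apply (le_of_approx (Z t) M 1); [lra|]. intros eps He.
    destruct (Hclt t eps He) as [n [Hn [B1 _]]]. destruct (HF n) as [_ [H1 _]].
    specialize (H1 t Hn). fold (X n) in H1. apply Rabs_def2 in B1. lra. }
assert (HZm : forall t, T <= t -> m <= exp (kappa * t) * Z t).
{ intros t Ht. assert (Hep := exp_pos (kappa * t)).
  apply (le_of_approx _ _ (exp (kappa * t))); [lra|]. intros eps He.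
  destruct (Hclt t eps He) as [n [Hn [B1 _]]]. destruct (HF n) as [_ [_ H1]].
  destruct (H1 t (conj Ht Hn)) as [H2 _]. fold (X n) in H2. apply Rabs_def2 in B1.
  assert (exp (kappa * t) * (X n t) <= exp (kappa * t) * (Z t + eps)) by (apply Rmult_le_compat_l; lra). lra. }
assert (HZpos : forall t, 0 < Z t).
{ intros t. destruct (HZ01 t) as [[Hp|Hz] _]; [exact Hp|exfalso].
  (* A zero of Z would be a minimum, and Z would vanish identically. *)
  assert (HV0 : VZ t = 0).
  { assert (Hmin := deriv_minimum Z (t - 1) (t + 1) t
      (exist _ (VZ t) (proj1 (is_derive_Reals Z t (VZ t)) (proj1 (HZ t))))).
    simpl in Hmin. apply Hmin; [lra|lra|]. intros s _ _. rewrite <- Hz. apply HZ01. }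
  assert (Hzero : truncated_solution (a - kappa) (b + kappa) ((P - 1) * kappa) 0 P Q M (fun _ => 0) (fun _ => 0)).
  { intros s. split; [apply is_derive_Rconst|]. eapply is_derive_val; [apply is_derive_Rconst|].
    unfold truncated_field, truncated_power. destruct (Rle_dec 0 0) as [_|H]; [ring|lra]. }
  assert (HZT := truncated_solution_unique _ _ _ _ P Q M t Z VZ (fun _ => 0) (fun _ => 0)
     HM HP HQ HZ Hzero (eq_sym Hz) HV0 T).
  assert (HmT := HZm T (Rle_refl _)). cbv beta in HZT. rewrite HZT in HmT. lra. }
exists (fun t => exp (- - kappa * t) * Z t), (fun t => exp (- - kappa * t) * (VZ t - - kappa * Z t)).
split.
- intros t. assert (Hc := HZ01 t).
  assert (H := solves_at_of_truncated _ _ _ _ _ _ _ Z VZ t HZ (conj (HZpos t) (proj2 Hc))).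
  apply (solves_at_shift (- kappa)) in H.
  replace (a - kappa - - kappa) with a in H by ring.
  replace (b + kappa + - kappa) with b in H by ring.
  replace ((P - 1) * kappa + (P - 1) * - kappa) with 0 in H by ring.
  replace (0 - (Q - 1) * - kappa) with ((Q - 1) * kappa) in H by ring. exact H.
- exists m. split; [exact Hm|]. intros S. exists (Rmax S T). split; [apply Rmax_l|].
  rewrite Ropp_involutive. apply HZm, Rmax_r.
Qed.

Lemma persistent_solution_backward_limit (a b kappa P Q : R) (w z : R -> R) :
  0 < b -> 0 < kappa -> b + 2 * kappa < a -> 1 < P -> 1 < Q ->
  solves a b 0 ((Q - 1) * kappa) P Q w z -> frequently_large w ->
  tends_to (fun s => exp (kappa * s) * w (- s)) (Rpower ((a - kappa) * (b + kappa)) (/ (Q - 1))).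
Proof.
intros Hb Hk Hab HP HQ Hsol Hfreq.
set (nu := (Q - 1) * kappa) in *. assert (Hnu : 0 < nu) by (unfold nu; nra).
set (mu := (P - 1) * kappa). assert (Hmu : 0 < mu) by (unfold mu; nra).
destruct (persistent_solution_limit a b nu P Q w z) as [Hw Hz]; try assumption; [lra|].
set (lam := Rpower (a * b) (/ (P - 1))) in *. assert (Hlam : 0 < lam) by apply Rpower_pos.
set (a' := a - kappa) in *. set (b' := b + kappa) in *.
set (B := a' * b') in *. assert (HB : 0 < B) by (apply Rmult_lt_0_compat; unfold a', b'; lra).
set (x := fun t => exp (- kappa * t) * w t).
set (v := fun t => exp (- kappa * t) * (z t - kappa * w t)).
assert (Hx : forall t, solves_at a' b' mu 0 P Q x v t).
{ intros t. assert (H := solves_at_shift kappa _ _ _ _ _ _ _ _ t (Hsol t)). fold a' b' x v in H.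
  replace (0 + (P - 1) * kappa) with mu in H by (unfold mu; ring).
  replace (nu - (Q - 1) * kappa) with 0 in H by (unfold nu; ring). exact H. }
set (E := energy a' b' mu 0 P Q x v).
set (dE := fun t => (a' - b') * v t ^ 2 + mu * (exp (mu * t) * (Rpower (x t) (P + 1) / (P + 1)))
     - 0 * (exp (- 0 * t) * (Rpower (x t) (Q + 1) / (Q + 1)))).
assert (HdE : forall t, is_derive E t (dE t)) by (intros t; apply is_derive_energy; [lra|lra|apply Hx]).
assert (HdEpos : forall t, 0 < dE t).
{ intros t. unfold dE. rewrite Rmult_0_l, Rminus_0_r. apply Rplus_le_lt_0_compat.
  - apply Rmult_le_pos; [unfold a', b'; lra|apply pow2_ge_0].
  - apply Rmult_lt_0_compat; [exact Hmu|]. apply Rmult_lt_0_compat; [apply exp_pos|].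
    apply Rdiv_lt_0_compat; [apply Rpower_pos|lra]. }
assert (Hmono : forall s t, s <= t -> E s <= E t).
{ intros s t Hst. apply (nondecreasing_of_derive E dE s t Hst).
  - intros r _. apply HdE.
  - intros r _. apply Rlt_le, HdEpos. }
(* As w and w' are bounded near +oo, the factor exp (- 2 kappa t) wins. *)
set (C := (1 + 2 * kappa * lam) ^ 2 / 2 + Rpower (2 * lam) (P + 1) / (P + 1) + Rpower (2 * lam) (Q + 1) / (Q + 1)).
assert (HEsmall : exists T1, 0 <= T1 /\ forall t, T1 <= t -> E t <= C * exp (- (2 * kappa) * t)).
{ destruct (Hw lam Hlam) as [T1 [HT1 B1]]. destruct (Hz 1 ltac:(lra)) as [T2 [HT2 B2]].
  exists (T1 + T2). split; [lra|]. intros t Ht.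
  specialize (B1 t ltac:(lra)). specialize (B2 t ltac:(lra)).
  apply Rabs_def2 in B1. apply Rabs_def2 in B2.
  assert (Hwt : 0 < w t) by apply Hsol.
  assert (HE := energy_shift kappa a b 0 nu P Q w z t Hwt). fold a' b' B x v in HE.
  replace (0 + (P - 1) * kappa) with mu in HE by (unfold mu; ring).
  replace (nu - (Q - 1) * kappa) with 0 in HE by (unfold nu; ring).
  fold E in HE. rewrite HE, (Rmult_comm C). apply Rmult_le_compat_l; [apply Rlt_le, exp_pos|].
  rewrite Rmult_0_l, exp_0, Rmult_1_l.
  assert (P1 : Rpower (w t) (P + 1) / (P + 1) <= Rpower (2 * lam) (P + 1) / (P + 1)).
  { apply Rmult_le_compat_r; [apply Rlt_le, Rinv_0_lt_compat; lra|apply Rpower_le_base; lra]. }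
  assert (P2 : Rpower (w t) (Q + 1) / (Q + 1) <= Rpower (2 * lam) (Q + 1) / (Q + 1)).
  { apply Rmult_le_compat_r; [apply Rlt_le, Rinv_0_lt_compat; lra|apply Rpower_le_base; lra]. }
  assert (P3 : exp (- nu * t) * (Rpower (w t) (Q + 1) / (Q + 1)) <= 1 * (Rpower (w t) (Q + 1) / (Q + 1))).
  { apply Rmult_le_compat_r; [|apply exp_neg_le_1; lra].
    apply Rlt_le, Rdiv_lt_0_compat; [apply Rpower_pos|lra]. }
  assert (P4 : (z t - kappa * w t) ^ 2 <= (1 + 2 * kappa * lam) ^ 2).
  { rewrite <- (pow2_abs (z t - kappa * w t)). apply pow_incr. split; [apply Rabs_pos|].
    assert (0 < kappa * w t < kappa * (2 * lam)) by nra. apply Rabs_le. lra. }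
  assert (P5 : 0 <= B * w t ^ 2) by (apply Rmult_le_pos; [lra|apply pow2_ge_0]).
  unfold C. lra. }
assert (HC : 0 < C).
{ assert (H1 : 0 < Rpower (2 * lam) (P + 1) / (P + 1)) by (apply Rdiv_lt_0_compat; [apply Rpower_pos|lra]).
  assert (H2 : 0 < Rpower (2 * lam) (Q + 1) / (Q + 1)) by (apply Rdiv_lt_0_compat; [apply Rpower_pos|lra]).
  assert (H3 := pow2_ge_0 (1 + 2 * kappa * lam)). unfold C. lra. }
assert (HE1 : E 1 <= 0).
{ apply le_epsilon. intros eps He. rewrite Rplus_0_l.
  destruct HEsmall as [T1 [HT1 B1]].
  destruct (exp_decay (2 * kappa) ltac:(lra) (eps / C)) as [T2 [HT2 B2]]; [now apply Rdiv_lt_0_compat|].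
  set (s := 1 + T1 + T2).
  specialize (B1 s ltac:(unfold s; lra)). specialize (B2 s ltac:(unfold s; lra)).
  rewrite Rminus_0_r, Rabs_pos_eq in B2 by apply Rlt_le, exp_pos.
  apply Rle_trans with (E s); [apply Hmono; unfold s; lra|].
  eapply Rle_trans; [exact B1|].
  replace eps with (C * (eps / C)) by (field; lra). apply Rmult_le_compat_l; lra. }
assert (HE0 : E 0 < 0).
{ destruct (mean_value E dE 0 1) as [c [_ Ec]]; [lra|intros s _; apply HdE|].
  assert (Hc := HdEpos c). lra. }
set (e := - E 0 / 2). assert (He : 0 < e) by (unfold e; lra).
set (M := well_radius B Q). assert (HM : 0 < M) by apply Rpower_pos.
assert (Hbounds : forall t, t <= 0 -> sqrt (2 * e / B) <= x t /\ x t <= M /\ Rabs (v t) <= (1 + B) * M).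
{ intros t Ht. assert (HEt := Hmono t 0 Ht). assert (Hxt : 0 < x t) by apply Hx.
  destruct (negative_energy a' b' mu 0 P Q x v e t HB HP HQ ltac:(lra) Hxt) as [N1 [N2 [_ N4]]].
  { fold E. unfold e. lra. }
  replace (- 0 * t) with 0 in N4 by ring. rewrite exp_0, Rmult_1_l in N4. fold B in N1, N2, N4.
  assert (HxM : x t < M) by (now apply well_radius_bound).
  split; [|split; [lra|]].
  - rewrite <- (sqrt_pow2 (x t)) by lra. apply sqrt_le_1_alt.
    apply Rmult_le_reg_l with B; [exact HB|].
    replace (B * (2 * e / B)) with (2 * e) by (field; lra). lra.
  - apply abs_le_of_sqr; [nra|].
    assert (x t ^ 2 <= M ^ 2) by (apply pow_incr; lra).
    assert (0 <= M ^ 2) by apply pow2_ge_0.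
    replace (((1 + B) * M) ^ 2) with (M ^ 2 + 2 * B * M ^ 2 + B ^ 2 * M ^ 2) by ring.
    assert (B * x t ^ 2 <= B * M ^ 2) by (apply Rmult_le_compat_l; lra).
    assert (0 <= B * M ^ 2) by (apply Rmult_le_pos; lra).
    assert (0 <= B ^ 2 * M ^ 2) by (apply Rmult_le_pos; [apply pow2_ge_0|lra]). lra. }
destruct (solution_settles b' a' mu Q P 0 M ((1 + B) * M) (fun s => x (- s)) (fun s => - v (- s)))
  as [_ Hh]; try assumption; [unfold a', b'; lra|lra| |].
{ intros s Hs. destruct (Hbounds (- s) ltac:(lra)) as [_ [H2 H3]].
  split; [|split; [exact H2|now rewrite Rabs_Ropp]].
  apply (solves_at_reflect a' b' mu 0 P Q x v s), Hx. }
assert (Hlim := balance_limit (fun s => x (- s)) (b' * a') Q (sqrt (2 * e / B)) 0).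
rewrite (Rmult_comm b' a') in Hlim, Hh. fold B in Hlim, Hh.
intros eps Heps.
destruct (Hlim HB HQ) with (eps := eps) as [T1 [HT1 H1]]; try assumption.
- apply sqrt_lt_R0, Rdiv_lt_0_compat; lra.
- intros s Hs. apply Hbounds. lra.
- exists T1. split; [exact HT1|]. intros s Hs.
  replace (exp (kappa * s) * w (- s)) with (x (- s)); [now apply H1|].
  unfold x. do 2 f_equal. ring.
Qed.

(** * Radial profiles and logarithmic time *)

(** Being eventually true along r = exp (sg t) as t -> +oo: for sg = 1 this is the
filter of neighbourhoods of infinity, for sg = -1 that of right neighbourhoods
of the origin. *)
Definition log_end (sg : R) (A : R -> Prop) : Prop :=
  exists T, forall t, T < t -> A (exp (sg * t)).

Lemma log_end_infinity (A : R -> Prop) : Rbar_locally p_infty A <-> log_end 1 A.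
Proof.
split.
- intros [M HM]. exists (ln (Rmax M 1)). intros t Ht. apply HM.
  rewrite Rmult_1_l. apply Rle_lt_trans with (Rmax M 1); [apply Rmax_l|].
  rewrite <- (exp_ln (Rmax M 1)); [now apply exp_increasing|].
  eapply Rlt_le_trans; [apply Rlt_0_1|apply Rmax_r].
- intros [T HT]. exists (exp T). intros x Hx.
  assert (H0 := exp_pos T). rewrite <- (exp_ln x) by lra.
  replace (ln x) with (1 * ln x) by ring. apply HT.
  rewrite <- (ln_exp T). apply ln_increasing; lra.
Qed.

Lemma log_end_origin (A : R -> Prop) : at_right 0 A <-> log_end (-1) A.
Proof.
split.
- intros [d Hd]. exists (- ln d). intros t Ht.
  assert (Hexp : exp (-1 * t) < d).
  { rewrite <- (exp_ln d) by apply cond_pos. apply exp_increasing. lra. }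
  apply Hd; [|apply exp_pos].
  change (Rabs (exp (-1 * t) - 0) < d). rewrite Rminus_0_r, Rabs_pos_eq; [exact Hexp|].
  apply Rlt_le, exp_pos.
- intros [T HT]. exists (mkposreal (exp (- T)) (exp_pos _)). intros x Hx Hx0.
  change (Rabs (x - 0) < exp (- T)) in Hx. rewrite Rminus_0_r, Rabs_pos_eq in Hx by lra.
  rewrite <- (exp_ln x) by exact Hx0.
  replace (ln x) with (-1 * - ln x) by ring. apply HT.
  apply (ln_increasing x) in Hx; [|exact Hx0]. rewrite ln_exp in Hx. lra.
Qed.

Lemma filterlim_of_tends_to (sg : R) (F : (R -> Prop) -> Prop) (f : R -> R) (l : R) :
  (forall A, F A <-> log_end sg A) -> tends_to (fun t => f (exp (sg * t))) l ->
  filterlim f F (locally l).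
Proof.
intros HF Hf A [eps HA]. apply HF.
destruct (Hf eps (cond_pos eps)) as [T [_ HT]].
exists T. intros t Ht. apply HA, HT. lra.
Qed.

(** A positive infimum of suprema leaves room for a positive level below it, which
the supremum over every tail then exceeds. *)
Lemma LimSup_pos_iff (sg : R) (F : (R -> Prop) -> Prop) (f : R -> R) :
  (forall A, F A <-> log_end sg A) ->
  (Rbar_lt 0 (LimSup F f) <-> frequently_large (fun t => f (exp (sg * t)))).
Proof.
intros HF. unfold LimSup.
set (S := fun y : Rbar => exists A : R -> Prop, F A /\ y = Lub_Rbar (fun z => exists r, A r /\ z = f r)).
destruct (proj2_sig (Rbar_ex_glb S)) as [Hlb Hglb]. change (proj1_sig (Rbar_ex_glb S)) with (Rbar_glb S) in Hlb, Hglb.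
split.
- intros Hpos.
  assert (Hc : exists c : R, 0 < c /\ Rbar_lt c (Rbar_glb S)).
  { destruct (Rbar_glb S) as [l| |].
    - exists (l / 2). simpl in *. lra.
    - exists 1. simpl. split; [lra|exact I].
    - destruct Hpos. }
  destruct Hc as [c [Hc HcS]]. exists c. split; [exact Hc|]. intros T.
  set (A := fun r => exists t, T < t /\ r = exp (sg * t)).
  assert (HA : F A) by (apply HF; exists T; intros t Ht; now exists t).
  destruct (Classical_Prop.classic (exists t, T <= t /\ c <= f (exp (sg * t)))) as [|Hno]; [assumption|exfalso].
  assert (H1 := Hlb _ (ex_intro _ A (conj HA eq_refl))).
  destruct (Lub_Rbar_correct (fun z => exists r, A r /\ z = f r)) as [_ Hlub].
  assert (H2 : Rbar_le (Lub_Rbar (fun z => exists r, A r /\ z = f r)) c).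
  { apply Hlub. intros z [r [[t [Ht ->]] ->]]. simpl. apply Rnot_lt_le. intros Hlt.
    apply Hno. exists t. lra. }
  assert (H3 := Rbar_lt_le_trans _ _ _ HcS (Rbar_le_trans _ _ _ H1 H2)). simpl in H3. lra.
- intros [c [Hc Hfreq]]. apply Rbar_lt_le_trans with c; [exact Hc|].
  apply Hglb. intros y [A [HA ->]].
  destruct (proj1 (HF A) HA) as [T HT]. destruct (Hfreq (T + 1)) as [t [Ht Hft]].
  destruct (Lub_Rbar_correct (fun z => exists r, A r /\ z = f r)) as [Hub _].
  apply Rbar_le_trans with (f (exp (sg * t))); [exact Hft|].
  apply Hub. exists (exp (sg * t)). split; [apply HT; lra|reflexivity].
Qed.

Definition log_solution (n : nat) (l1 l2 p q sg : R) (y v : R -> R) : Prop :=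
  forall t, 0 < y t /\ is_derive y t (v t) /\
    is_derive v t (- (sg * (INR n - 2)) * v t - exp (sg * (2 + l1) * t) * Rpower (y t) p
                   - exp (sg * (2 + l2) * t) * Rpower (y t) q).

Lemma Rpower_exp (s x : R) : Rpower (exp s) x = exp (x * s).
Proof. unfold Rpower. now rewrite ln_exp. Qed.

Lemma log_solution_of_radial (n : nat) (l1 l2 p q sg : R) (u : R -> R) :
  sg * sg = 1 -> positive_radial_solution n l1 l2 p q u ->
  log_solution n l1 l2 p q sg (fun t => u (exp (sg * t)))
    (fun t => sg * exp (sg * t) * Derive u (exp (sg * t))).
Proof.
intros Hsg [HC2 [Hpos Heq]] t.
set (r := exp (sg * t)). assert (Hr : 0 < r) by apply exp_pos.
destruct (HC2 r Hr) as [Hu1 [Hu2 _]].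
apply Derive_correct in Hu1. apply Derive_correct in Hu2.
assert (Hexp := is_derive_exp_lin sg t). fold r in Hexp.
split; [now apply Hpos|split].
- eapply is_derive_val.
  + exact (is_derive_Rcomp u (fun s => exp (sg * s)) t _ _ Hu1 Hexp).
  + ring.
- eapply is_derive_val.
  + apply is_derive_Rmult; [apply is_derive_Rscal, Hexp|].
    exact (is_derive_Rcomp (Derive u) (fun s => exp (sg * s)) t _ _ Hu2 Hexp).
  + cbv beta. fold r.
    assert (E := Heq r Hr).
    assert (Hpow : forall l, exp (sg * (2 + l) * t) = r ^ 2 * Rpower r l).
    { intros l. unfold r. rewrite Rpower_exp. simpl. rewrite Rmult_1_r, <- !exp_plus. f_equal. ring. }
    rewrite !Hpow.
    assert (E' : r ^ 2 * Derive (Derive u) r = - (INR n - 1) * r * Derive u r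
       - r ^ 2 * Rpower r l1 * Rpower (u r) p - r ^ 2 * Rpower r l2 * Rpower (u r) q).
    { replace (Derive (Derive u) r) with (- ((INR n - 1) / r * Derive u r
        + Rpower r l1 * Rpower (u r) p + Rpower r l2 * Rpower (u r) q)) by lra.
      field. lra. }
    replace (sg * (sg * r) * Derive u r + sg * r * (Derive (Derive u) r * (sg * r)))
      with (sg * sg * (r * Derive u r + r ^ 2 * Derive (Derive u) r)) by ring.
    rewrite E'.
    replace (- (sg * (INR n - 2)) * (sg * r * Derive u r))
      with (sg * sg * (- (INR n - 2) * r * Derive u r)) by ring.
    rewrite Hsg. ring.
Qed.

Lemma locally_pos (r : R) : 0 < r -> locally r (fun x => 0 < x).
Proof.
intros Hr. exists (mkposreal r Hr). intros x Hx.
change (Rabs (x - r) < r) in Hx. apply Rabs_def2 in Hx. lra.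
Qed.

Lemma radial_of_log_solution (n : nat) (l1 l2 p q sg : R) (y v : R -> R) :
  sg * sg = 1 -> log_solution n l1 l2 p q sg y v ->
  positive_radial_solution n l1 l2 p q (fun r => y (sg * ln r)).
Proof.
intros Hsg H. set (u := fun r => y (sg * ln r)).
assert (Hln : forall r, 0 < r -> is_derive (fun s => sg * ln s) r (sg * / r)).
{ intros r Hr. apply is_derive_Rscal, is_derive_ln, Hr. }
set (du := fun r => v (sg * ln r) * (sg * / r)).
assert (Hu : forall r, 0 < r -> is_derive u r (du r)).
{ intros r Hr. apply (is_derive_Rcomp y (fun s => sg * ln s) r); [apply H|now apply Hln]. }
set (d2u := fun r => - (INR n - 1) * (/ r * du r) - Rpower r l1 * Rpower (u r) p - Rpower r l2 * Rpower (u r) q).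
assert (Hinv : forall r, 0 < r -> is_derive Rinv r (- / r ^ 2)).
{ intros r Hr. eapply is_derive_val; [apply is_derive_inv; [exact (is_derive_id r)|lra]|].
  unfold one; simpl. field. lra. }
assert (Hdu : forall r, 0 < r -> is_derive du r (d2u r)).
{ intros r Hr. eapply is_derive_val.
  - apply is_derive_Rmult.
    + apply (is_derive_Rcomp v (fun s => sg * ln s) r); [apply H|now apply Hln].
    + apply is_derive_Rscal, Hinv, Hr.
  - unfold d2u, du. fold (u r).
    assert (Hpow : forall l, exp (sg * (2 + l) * (sg * ln r)) = r ^ 2 * Rpower r l).
    { intros l. replace (sg * (2 + l) * (sg * ln r)) with (sg * sg * (2 + l) * ln r) by ring.
      rewrite Hsg, Rmult_1_l. change (exp ((2 + l) * ln r)) with (Rpower r (2 + l)).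
      rewrite Rpower_plus. f_equal. rewrite <- (Rpower_pow 2 r Hr). f_equal. }
    rewrite !Hpow. change (y (sg * ln r)) with (u r).
    set (V := v (sg * ln r)).
    replace ((- (sg * (INR n - 2)) * V - r ^ 2 * Rpower r l1 * Rpower (u r) p - r ^ 2 * Rpower r l2 * Rpower (u r) q)
       * (sg * / r) * (sg * / r) + V * (sg * - / r ^ 2))
     with (- (sg * sg) * sg * (INR n - 2) * V / r ^ 2 - sg * V / r ^ 2
           - sg * sg * (Rpower r l1 * Rpower (u r) p) - sg * sg * (Rpower r l2 * Rpower (u r) q))
     by (field; lra).
    rewrite Hsg. field. lra. }
assert (HD1 : forall r, 0 < r -> Derive u r = du r) by (intros r Hr; now apply is_derive_unique, Hu).
assert (HD2' : forall r, 0 < r -> is_derive (Derive u) r (d2u r)).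
{ intros r Hr. apply (is_derive_ext_loc du); [|now apply Hdu].
  generalize (locally_pos r Hr). apply filter_imp. intros x Hx. symmetry. now apply HD1. }
assert (HD2 : forall r, 0 < r -> Derive (Derive u) r = d2u r) by (intros r Hr; now apply is_derive_unique, HD2').
assert (Hupos : forall r, 0 < u r) by (intros r; apply H).
split; [|split].
- intros r Hr. split; [exists (du r); now apply Hu|split; [exists (d2u r); now apply HD2'|]].
  apply (continuous_ext_loc _ d2u).
  { generalize (locally_pos r Hr). apply filter_imp. intros x Hx. symmetry. now apply HD2. }
  assert (Hid := is_derive_id r).
  assert (Hpl : forall l, is_derive (fun s => Rpower s l) r (l * Rpower r (l - 1) * 1))
    by (intros l; now apply (is_derive_Rpower (fun s => s) l r 1)).
  eapply is_derive_continuous.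
  apply is_derive_Rminus; [apply is_derive_Rminus|].
  + apply is_derive_Rscal, is_derive_Rmult; [now apply Hinv|now apply Hdu].
  + apply is_derive_Rmult; [apply Hpl|apply is_derive_Rpower; [apply Hupos|now apply Hu]].
  + apply is_derive_Rmult; [apply Hpl|apply is_derive_Rpower; [apply Hupos|now apply Hu]].
- intros r _. apply Hupos.
- intros r Hr. rewrite HD2, HD1 by exact Hr. unfold d2u. fold (u r). field. lra.
Qed.

Lemma solves_ext (a b mu nu P Q : R) (y v y' v' : R -> R) :
  (forall t, y t = y' t) -> (forall t, v t = v' t) ->
  solves a b mu nu P Q y v -> solves a b mu nu P Q y' v'.
Proof.
intros Hy Hv H t. destruct (H t) as [H1 [H2 H3]]. unfold solves_at.
rewrite <- Hy, <- Hv. split; [exact H1|split].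
- now apply (is_derive_ext y).
- now apply (is_derive_ext v).
Qed.

(** Both cases of the theorem, with the passage between the logarithmic equation
and its normal form left as the last two hypotheses.  The exponent
th - sg * kappa at the other end is the one that turns r^th u = w into
exp (- kappa t) w. *)
Lemma unique_radial_solution (n : nat) (l1 l2 p q sg th a b kappa P Q : R)
    (F F' : (R -> Prop) -> Prop) :
  sg * sg = 1 -> 0 < b -> 0 < kappa -> b + 2 * kappa < a -> 1 < P -> 1 < Q ->
  (forall A, F A <-> log_end sg A) -> (forall A, F' A <-> log_end (- sg) A) ->
  (forall y v, log_solution n l1 l2 p q sg y v ->
     exists z, solves a b 0 ((Q - 1) * kappa) P Q (fun t => exp (th * (sg * t)) * y t) z) ->
  (forall w z, solves a b 0 ((Q - 1) * kappa) P Q w z ->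
     exists v, log_solution n l1 l2 p q sg (fun t => exp (- (th * (sg * t))) * w t) v) ->
  exists u : R -> R,
    is_the_only_profile (fun v => positive_radial_solution n l1 l2 p q v /\
       Rbar_lt 0 (LimSup F (fun r => Rpower r th * v r))) u /\
    filterlim (fun r => Rpower r th * u r) F (locally (Rpower (a * b) (/ (P - 1)))) /\
    filterlim (fun r => Rpower r (th - sg * kappa) * u r) F'
      (locally (Rpower ((a - kappa) * (b + kappa)) (/ (Q - 1)))).
Proof.
intros Hsg Hb Hk Hab HP HQ HF HF' Hto Hfrom.
assert (Hnu : 0 < (Q - 1) * kappa) by (apply Rmult_lt_0_compat; lra).
destruct (persistent_solution_exists a b kappa P Q Hb Hk Hab HP HQ) as [w [z [Hw Hlarge]]].
destruct (Hfrom w z Hw) as [v Hv].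
set (u := fun r => exp (- (th * (sg * (sg * ln r)))) * w (sg * ln r)).
assert (Hu : positive_radial_solution n l1 l2 p q u) by exact (radial_of_log_solution n l1 l2 p q sg _ v Hsg Hv).
assert (Hss : forall x, sg * (sg * x) = x).
{ intros x. rewrite <- Rmult_assoc, Hsg. ring. }
assert (Huw : forall t, u (exp (sg * t)) = exp (- (th * (sg * t))) * w t).
{ intros t. unfold u. now rewrite ln_exp, !Hss. }
exists u. split; [split; [split; [exact Hu|]|]|split].
- apply (LimSup_pos_iff sg F); [exact HF|].
  destruct Hlarge as [c [Hc Hfreq]]. exists c. split; [exact Hc|]. intros T.
  destruct (Hfreq T) as [t [Ht Hwt]]. exists t. split; [exact Ht|].
  rewrite Huw, Rpower_exp, <- Rmult_assoc, <- exp_plus, Rplus_opp_r, exp_0. lra.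
- intros u' [Hu' Hsing] r Hr.
  apply (LimSup_pos_iff sg F) in Hsing; [|exact HF].
  destruct (Hto _ _ (log_solution_of_radial n l1 l2 p q sg u' Hsg Hu')) as [z' Hz'].
  assert (Hlarge' : frequently_large (fun t => exp (th * (sg * t)) * u' (exp (sg * t)))).
  { destruct Hsing as [c [Hc Hfreq]]. exists c. split; [exact Hc|]. intros T.
    destruct (Hfreq T) as [t [Ht Hwt]]. exists t. split; [exact Ht|].
    now rewrite Rpower_exp in Hwt. }
  assert (E := persistent_solution_unique a b ((Q - 1) * kappa) P Q _ z' w z
     Hb ltac:(lra) Hnu HP HQ Hz' Hlarge' Hw Hlarge (sg * ln r)).
  cbv beta in E. rewrite Hss, exp_ln in E by exact Hr.
  unfold u. rewrite Hss, <- E, <- Rmult_assoc, <- exp_plus, Rplus_opp_l, exp_0. ring.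
- apply (filterlim_of_tends_to sg F); [exact HF|].
  destruct (persistent_solution_limit a b ((Q - 1) * kappa) P Q w z) as [Hlim _]; try assumption; [lra|].
  intros eps Heps. destruct (Hlim eps Heps) as [T [HT HTe]]. exists T. split; [exact HT|].
  intros t Ht. rewrite Huw, Rpower_exp, <- Rmult_assoc, <- exp_plus, Rplus_opp_r, exp_0, Rmult_1_l.
  now apply HTe.
- apply (filterlim_of_tends_to (- sg) F'); [exact HF'|].
  assert (Hlim := persistent_solution_backward_limit a b kappa P Q w z Hb Hk Hab HP HQ Hw Hlarge).
  intros eps Heps. destruct (Hlim eps Heps) as [T [HT HTe]]. exists T. split; [exact HT|].
  intros t Ht. specialize (HTe t Ht).
  replace (Rpower (exp (- sg * t)) (th - sg * kappa) * u (exp (- sg * t))) with (exp (kappa * t) * w (- t));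
    [exact HTe|].
  replace (- sg * t) with (sg * - t) by ring.
  rewrite Huw, Rpower_exp, <- Rmult_assoc, <- exp_plus. do 2 f_equal.
  replace ((th - sg * kappa) * (sg * - t)) with (th * (sg * - t) + sg * sg * kappa * t) by ring.
  rewrite Hsg. ring.
Qed.

Theorem theorem3 (n : nat) (l1 l2 p q : R) (hn : (3 <= n)%nat) :
  ((-2 < l2 /\ l2 < l1 /\ l1 <= 0) ->
   ((INR n + l1) / (INR n - 2) < p /\ p < q /\
    q < (INR n + 2 + 2 * l2) / (INR n - 2)) ->
   exists u : R -> R,
     is_the_only_profile
       (fun v => positive_radial_solution n l1 l2 p q v /\
                 singular_at_infinity l1 p v) u /\
     has_limits n l1 l2 p q u)
  /\
  ((-2 < l2 /\ l2 < l1 /\ l1 <= 0) ->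
   ((INR n + 2 + 2 * l1) / (INR n - 2) < p /\ p < q) ->
   exists u : R -> R,
     is_the_only_profile
       (fun v => positive_radial_solution n l1 l2 p q v /\
                 singular_at_origin l2 q v) u /\
     has_limits n l1 l2 p q u).
Proof.
assert (Hn : 0 < INR n - 2).
{ apply le_INR in hn. simpl in hn. lra. }
set (a1 := alpha l1 p). set (a2 := alpha l2 q).
assert (Hlt : forall x y, x / (INR n - 2) < y -> x < y * (INR n - 2)).
{ intros x y H. apply Rmult_lt_compat_r with (r := INR n - 2) in H; [|lra].
  replace (x / (INR n - 2) * (INR n - 2)) with x in H by (field; lra). exact H. }
assert (Hgt : forall x y, y < x / (INR n - 2) -> y * (INR n - 2) < x).
{ intros x y H. apply Rmult_lt_compat_r with (r := INR n - 2) in H; [|lra].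
  replace (x / (INR n - 2) * (INR n - 2)) with x in H by (field; lra). exact H. }
assert (Halpha : forall l s, 1 < s -> (s - 1) * alpha l s = 2 + l).
{ intros l s Hs. unfold alpha. field. lra. }
assert (Horder : -2 < l2 -> l2 < l1 -> 1 < p -> p < q -> 0 < a2 < a1).
{ intros H1 H2 H3 H4. assert (E1 := Halpha l1 p H3). assert (E2 := Halpha l2 q ltac:(lra)).
  fold a1 in E1. fold a2 in E2.
  assert (0 < a2) by nra. split; [lra|]. nra. }
split.
- intros [hl2 [hl1 _]] [hp1 [hpq hq]].
  apply Hlt in hp1. apply Hgt in hq.
  assert (Hp : 1 < p) by nra.
  destruct (Horder hl2 hl1 Hp hpq) as [Ha2 Ha1].
  assert (E1 := Halpha l1 p Hp). assert (E2 := Halpha l2 q ltac:(lra)). fold a1 in E1. fold a2 in E2.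
  assert (Hb1 : a1 < INR n - 2) by nra.
  assert (Hb2 : INR n - 2 < 2 * a2) by nra.
  destruct (unique_radial_solution n l1 l2 p q 1 a1 a1 (INR n - 2 - a1) (a1 - a2) p q
    (Rbar_locally p_infty) (at_right 0)) as [u [Hu [L1 L2]]]; try lra.
  + exact log_end_infinity.
  + exact log_end_origin.
  + intros y v H. eexists.
    assert (Hs : solves 0 (INR n - 2) (2 + l1) (- (2 + l2)) p q y v).
    { intros t. destruct (H t) as [H1 [H2 H3]]. split; [exact H1|split; [exact H2|]].
      eapply is_derive_val; [exact H3|].
      rewrite !Rmult_1_l, Ropp_involutive. ring. }
    assert (Hs' := fun t => solves_at_shift (- a1) _ _ _ _ _ _ _ _ t (Hs t)).
    replace (0 - - a1) with a1 in Hs' by ring.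
    replace (INR n - 2 + - a1) with (INR n - 2 - a1) in Hs' by ring.
    replace (2 + l1 + (p - 1) * - a1) with 0 in Hs' by lra.
    replace (- (2 + l2) - (q - 1) * - a1) with ((q - 1) * (a1 - a2)) in Hs' by lra.
    eapply solves_ext; [| |exact Hs']; [|reflexivity].
    intros t. cbv beta. now rewrite Ropp_involutive, Rmult_1_l.
  + intros w z H.
    assert (Hs' := fun t => solves_at_shift a1 _ _ _ _ _ _ _ _ t (H t)).
    replace (a1 - a1) with 0 in Hs' by ring.
    replace (INR n - 2 - a1 + a1) with (INR n - 2) in Hs' by ring.
    replace (0 + (p - 1) * a1) with (2 + l1) in Hs' by lra.
    replace ((q - 1) * (a1 - a2) - (q - 1) * a1) with (- (2 + l2)) in Hs' by lra.
    exists (fun t => exp (- (a1) * t) * (z t - (a1) * w t)).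
    assert (Hs : solves 0 (INR n - 2) (2 + l1) (- (2 + l2)) p q (fun t => exp (- (a1 * (1 * t))) * w t)
                   (fun t => exp (- (a1) * t) * (z t - (a1) * w t))).
    { eapply solves_ext; [| |exact Hs']; [|reflexivity].
      intros t. cbv beta. do 2 f_equal. ring. }
    intros t. destruct (Hs t) as [H1 [H2 H3]].
    split; [exact H1|split; [exact H2|]].
    eapply is_derive_val; [exact H3|].
    rewrite !Rmult_1_l, Ropp_involutive. ring.
  + exists u. split; [exact Hu|]. split.
    * exact L1.
    * replace (a1 - 1 * (a1 - a2)) with a2 in L2 by ring.
      replace (a1 - (a1 - a2)) with a2 in L2 by ring.
      replace (INR n - 2 - a1 + (a1 - a2)) with (INR n - 2 - a2) in L2 by ring. exact L2.
- intros [hl2 [hl1 _]] [hp1 hpq].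
  apply Hlt in hp1.
  assert (Hp : 1 < p) by nra.
  destruct (Horder hl2 hl1 Hp hpq) as [Ha2 Ha1].
  assert (E1 := Halpha l1 p Hp). assert (E2 := Halpha l2 q ltac:(lra)). fold a1 in E1. fold a2 in E2.
  assert (Hb1 : 2 * a1 < INR n - 2) by nra.
  destruct (unique_radial_solution n l1 l2 p q (-1) a2 (INR n - 2 - a2) a2 (a1 - a2) q p
    (at_right 0) (Rbar_locally p_infty)) as [u [Hu [L1 L2]]]; try lra.
  + exact log_end_origin.
  + intros A. replace (- -1) with 1 by ring. apply log_end_infinity.
  + intros y v H. eexists.
    assert (Hs : solves (INR n - 2) 0 (- (2 + l2)) (2 + l1) q p y v).
    { intros t. destruct (H t) as [H1 [H2 H3]]. split; [exact H1|split; [exact H2|]].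
      eapply is_derive_val; [exact H3|].
      replace (-1 * (2 + l1)) with (- (2 + l1)) by ring.
      replace (-1 * (2 + l2)) with (- (2 + l2)) by ring. ring. }
    assert (Hs' := fun t => solves_at_shift a2 _ _ _ _ _ _ _ _ t (Hs t)).
    replace (0 + a2) with a2 in Hs' by ring.
    replace (- (2 + l2) + (q - 1) * a2) with 0 in Hs' by lra.
    replace (2 + l1 - (p - 1) * a2) with ((p - 1) * (a1 - a2)) in Hs' by lra.
    eapply solves_ext; [| |exact Hs']; [|reflexivity].
    intros t. cbv beta. do 2 f_equal. ring.
  + intros w z H.
    assert (Hs' := fun t => solves_at_shift (- a2) _ _ _ _ _ _ _ _ t (H t)).
    replace (a2 + - a2) with 0 in Hs' by ring.
    replace (INR n - 2 - a2 - - a2) with (INR n - 2) in Hs' by ring.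
    replace (0 + (q - 1) * - a2) with (- (2 + l2)) in Hs' by lra.
    replace ((p - 1) * (a1 - a2) - (p - 1) * - a2) with (2 + l1) in Hs' by lra.
    exists (fun t => exp (- (- a2) * t) * (z t - (- a2) * w t)).
    assert (Hs : solves (INR n - 2) 0 (- (2 + l2)) (2 + l1) q p (fun t => exp (- (a2 * (-1 * t))) * w t)
                   (fun t => exp (- (- a2) * t) * (z t - (- a2) * w t))).
    { eapply solves_ext; [| |exact Hs']; [|reflexivity].
      intros t. cbv beta. do 2 f_equal. ring. }
    intros t. destruct (Hs t) as [H1 [H2 H3]].
    split; [exact H1|split; [exact H2|]].
    eapply is_derive_val; [exact H3|].
    replace (-1 * (2 + l1)) with (- (2 + l1)) by ring.
    replace (-1 * (2 + l2)) with (- (2 + l2)) by ring. ring.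
  + exists u. split; [exact Hu|]. split.
    * replace (a2 - -1 * (a1 - a2)) with a1 in L2 by ring.
      replace (INR n - 2 - a2 - (a1 - a2)) with (INR n - 2 - a1) in L2 by ring.
      replace (a2 + (a1 - a2)) with a1 in L2 by ring.
      rewrite (Rmult_comm (INR n - 2 - a1)) in L2. exact L2.
    * rewrite (Rmult_comm (INR n - 2 - a2)) in L1. exact L1.
Qed.
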